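(* Let $n\in\mathbb{N}$ and let $Z_\rho=\frac{\ln(1-\rho)}{\ln\rho}$ for $\rho\in(0,1)$. The following holds for any $m\in\mathbb{N}$: (a) There is a function $\phi:(0,1)\to[0,\infty)$ such that $E\bigl(\widetilde X_{\rho,n}^m\bigr)\le\phi(\rho)$ for all $\rho\in(0,1)$ and $$\phi(\rho)\sim Z_\rho^m\Bigl(\frac{1-\rho}{2\pi}\Bigr)^{\frac n2}\exp\Bigl\{\frac{\pi^2}{6}\,\frac{mn}{1-\rho}\Bigr\}\quad\text{as }\rho\uparrow1.$$ (b) For any function $\delta:(0,1)\to(0,1)$ such that $\lim_{\rho\uparrow1}\delta(\rho)=0$ and $\lim_{\rho\uparrow1}(1-\rho)^{\delta(\rho)}=0$, there is a function $\psi_\delta:(0,1)\to[0,\infty)$ such that $E\bigl(\widetilde X_{\rho,n}^m\bigr)\ge\psi_\delta(\rho)$ for all $\rho\in(0,1)$ and $$\psi_\delta(\rho)\sim m!\,Z_\rho^m\exp\Bigl\{\frac{mn}{(1-\rho)^{\delta(\rho)}}\Bigr\}\quad\text{as }\rho\uparrow1.$$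
   Context: $\mathbb{N}=\{1,2,3,\dots\}$. $f(\rho)\sim g(\rho)$ as $\rho\uparrow1$ means $\lim_{\rho\uparrow1}f(\rho)/g(\rho)=1$. Frog model on the whole of $\mathbb{Z}$ with $n$ frogs per site. Fix $\rho\in(0,1)$ and let $p=\frac{1}{1+\rho}\in(\tfrac12,1)$, so that $\rho=\frac{1-p}{p}$; fix $n\in\mathbb{N}$. At every site $x\in\mathbb{Z}$ there are initially exactly $n$ particles (''frogs''). At time $0$ the $n$ frogs at the origin are active and all others are sleeping. Active frogs perform, in discrete time, simultaneously and independently of each other, nearest-neighbour random walks on $\mathbb{Z}$, each step being $+1$ with probability $p$ and $-1$ with probability $1-p$. When an active frog visits a site containing sleeping frogs, all of them become active and from then on each performs the same kind of random walk starting from its initial location; all random walk transitions are independent. $\widetilde X_{\rho,n}$ denotes the negative of the left-most site visited by any of the active frogs (almost surely finite). *)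

(* Defs.v *)
(* MathComp-Analysis, over an arbitrary R : realType. *)
From HB Require Import structures.
From mathcomp Require Import all_boot all_order all_algebra finmap.
From mathcomp Require Import all_classical all_reals all_analysis.

Set Implicit Arguments.
Unset Strict Implicit.
Unset Printing Implicit Defensive.

Import Order.TTheory GRing.Theory Num.Theory.
Import numFieldNormedType.Exports.

Local Open Scope classical_set_scope.
Local Open Scope ring_scope.

Definition mutually_independent d (T : measurableType d) (R : realType)
    (P : probability T R) (I : choiceType) d' (U : measurableType d')
    (X : I -> {mfun T >-> U}) : Prop :=
  forall (J : {fset I}) (A : I -> set U), (forall j, measurable (A j)) ->
    P (\bigcap_(j in [set` J]) (X j @^-1` A j)) =
    (\prod_(j <- J) P (X j @^-1` A j))%E.

(* The index (x, i, k) designates the k-th step, counted from its activation,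
   of the i-th frog initially located at x; the value true stands for a step
   +1 and false for a step -1. *)
Notation frog_step n := (int * 'I_n * nat)%type.

Definition frog_law (R : realType) (rho : R) (n : nat)
    d (T : measurableType d) (P : probability T R)
    (xi : frog_step n -> {mfun T >-> bool}) : Prop :=
  (forall a, P (xi a @^-1` [set true]) = ((1 + rho)^-1)%:E) /\
  mutually_independent P xi.

Section dynamics.
Variables (n : nat) (c : frog_step n -> bool).

Definition displacement (x : int) (i : 'I_n) (k : nat) : int :=
  \sum_(j < k) (if c (x, i, nat_of_ord j) then 1 else - 1).

(* [a x = Some s] means that the frogs of x were activated at time s, and
   [a x = None] that they are still sleeping. *)
Definition active_frog_at (a : int -> option nat) (t : nat) (y : int) : Prop :=
  exists (x : int) (i : 'I_n) (s : nat),
    a x = Some s /\ x + displacement x i (t - s) = y.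

(* [activation t x] is the activation time of the frogs of x if they have been
   activated by time t, and None otherwise. *)
Fixpoint activation (t : nat) : int -> option nat :=
  match t with
  | 0%N => fun x => if x == 0 then Some 0%N else None
  | t'.+1 => fun x =>
      if activation t' x is Some s then Some s
      else if `[< active_frog_at (activation t') t'.+1 x >] then Some t'.+1
      else None
  end.

Definition visited : set int :=
  [set y | exists t, active_frog_at (activation t) t y].

End dynamics.

(* +oo on the (negligible) event that arbitrarily negative sites are visited *)
Definition neg_leftmost (R : realType) (n : nat)
    (c : frog_step n -> bool) : \bar R :=
  (- ereal_inf [set (y%:~R : R)%:E | y in visited c])%E.

Definition frog_moment (R : realType) (n m : nat)
    d (T : measurableType d) (P : probability T R)
    (xi : frog_step n -> {mfun T >-> bool}) : \bar R :=
  (\int[P]_w (neg_leftmost R (fun a => xi a w)) ^+ m)%E.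

Definition Zrho (R : realType) (rho : R) : R := ln (1 - rho) / ln rho.

Definition equiv_at_1 (R : realType) (f g : R -> R) : Prop :=
  (fun rho => f rho / g rho) @ 1^'- --> (1 : R).

(* Main.v *)
(* The walk of a frog started at x ever reaches x - j with probability rho^j. The
   site - k is visited exactly when each of - 1, ..., - k is reached by some frog
   from its right (almost surely, for frogs at x >= 0 are all activated).

   Let u_k = prod_(j <= k) (1 - rho^j)^n be the probability that a given site is
   reached from none of the k sites on its right, and t_k the probability that
   - 1, ..., - k are all reached. Conditioning on the distance i of the nearest frog
   reaching - k gives the defective renewal inequality
     t_k <= sum_(i <= k) (u_(i-1) - u_i) t_(k-i) + (u_k - u_oo),
   hence an exponential moment of rate of order (1 - rho) u_oo and, for the m-th
   moment, a bound m! (16 n / ((1 - rho) u_oo))^m. Euler's product satisfies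
     prod_j (1 - rho^j)^-1 <= (1 - rho)^(1/2) exp (pi^2 / (6 (1 - rho))),
   and the factor Z_rho^m in (a), which is of order (ln (1 - rho) / (1 - rho))^m,
   absorbs the constants and the powers of 1 / (1 - rho).

   For (b) the union bound over l <= 2^K, with K close to 1 / (2 (1 - rho)), shows
   that - 2^K is visited with probability at least 1/2; the moment 2^(K m) / 2 is
   far larger than the required exp (m n (1 - rho)^-delta).

   In both parts the function is the prescribed equivalent near 1, replaced by
   a trivially correct value where the comparison fails. *)

Require Import Defs.
From HB Require Import structures.
From mathcomp Require Import all_boot all_order all_algebra finmap.
From mathcomp Require Import all_classical all_reals all_analysis.
From mathcomp Require Import measurable_realfun.
From mathcomp Require Import zify ring lra.

Set Implicit Arguments.
Unset Strict Implicit.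
Unset Printing Implicit Defensive.

Import Order.TTheory GRing.Theory Num.Theory.
Import numFieldNormedType.Exports.

Local Open Scope classical_set_scope.
Local Open Scope ring_scope.

(** * Partial sums of zeta(2) *)

Lemma is_derive_continuous_within (R : realType) (f df : R -> R) (a b : R) :
  (forall x : R, a <= x <= b -> is_derive x 1 f (df x)) -> {within `[a, b], continuous f}.
Proof.
move=> H; apply: derivable_within_continuous => x; rewrite in_itv/= => hx.
exact: (@ex_derive _ _ _ _ _ _ _ (H x hx)).
Qed.

Lemma sin_le_id (R : realType) (x : R) : 0 <= x -> sin x <= x.
Proof.
move=> x0.
have H (y : R) : is_derive y 1 (fun y : R => y - sin y) (1 - cos y).
  exact: is_deriveB.
have C : {within `[0, x], continuous (fun y : R => y - sin y)}.
  exact: is_derive_continuous_within (fun y _ => H y).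
have [c _] := MVT_segment x0 (fun y _ => H y) C.
rewrite sin0 !subr0 => e.
by rewrite -subr_ge0 e mulr_ge0// subr_ge0 cos_le1.
Qed.


Lemma sin_inv2D_cos_inv2 (R : realType) (x : R) : sin x != 0 -> cos x != 0 ->
  sin x ^- 2 + cos x ^- 2 = 4 * sin (x *+ 2) ^- 2.
Proof.
move=> s0 c0; rewrite sin_mulr2n.
have := cos2Dsin2 x.
set s := sin x in s0 *; set c := cos x in c0 * => e.
have -> : s ^- 2 + c ^- 2 = (c ^+ 2 + s ^+ 2) * (s ^- 2 * c ^- 2) by field; rewrite s0 c0.
by rewrite e; field; rewrite s0 c0.
Qed.

Lemma dyadic_angle (R : realType) (N k : nat) : (0 < k < 2 ^ N)%N ->
  0 < (k%:R * pi / (2 ^ N.+1)%:R : R) < pi / 2.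
Proof.
move=> /andP[k0 kN]; have p0 : 0 < (2 ^ N.+1)%:R :> R by rewrite ltr0n expn_gt0.
apply/andP; split; first by rewrite divr_gt0// mulr_gt0 ?ltr0n// pi_gt0.
have -> : pi / 2 = (2 ^ N)%:R * pi / (2 ^ N.+1)%:R :> R.
  by rewrite expnS natrM; field; rewrite pnatr_eq0 expn_eq0.
by rewrite ltr_pM2r ?invr_gt0// ltr_pM2r ?pi_gt0// ltr_nat.
Qed.

(* The doubling recursion S_(N+1) = 4 S_N + 1 comes from
   sin^-2 x + sin^-2 (x + pi/2) = 4 sin^-2 (2x). *)
Lemma sum_sin_inv2 (R : realType) (N : nat) :
  \sum_(1 <= k < 2 ^ N) (sin (k%:R * pi / (2 ^ N)%:R : R)) ^- 2 =
    ((4 ^ N)%:R - 1) / 3 /\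
  \sum_(1 <= k < 2 ^ N) (sin (k%:R * pi / (2 ^ N.+1)%:R : R)) ^- 2 =
    2 * ((4 ^ N)%:R - 1) / 3.
Proof.
suff [D E] : \sum_(1 <= k < 2 ^ N) (sin (k%:R * pi / (2 ^ N)%:R : R)) ^- 2 =
    ((4 ^ N)%:R - 1) / 3 /\
  \sum_(1 <= k < 2 ^ N) (sin (k%:R * pi / (2 ^ N.+1)%:R : R)) ^- 2 =
  2 * \sum_(1 <= k < 2 ^ N) (sin (k%:R * pi / (2 ^ N)%:R : R)) ^- 2.
  by split => //; rewrite E D mulrA.
(* The reflection [k -> 2^M - k] exchanges sines and cosines, so each of the two sums at the finer
   angles is twice the sum at the coarser ones. *)
have half M : let s k : R := sin (k%:R * pi / (2 ^ M.+1)%:R) in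
    let c k : R := cos (k%:R * pi / (2 ^ M.+1)%:R) in
    \sum_(1 <= k < 2 ^ M) s k ^- 2 = \sum_(1 <= k < 2 ^ M) c k ^- 2 /\
    \sum_(1 <= k < 2 ^ M) s k ^- 2 + \sum_(1 <= k < 2 ^ M) c k ^- 2 =
    4 * \sum_(1 <= k < 2 ^ M) sin (k%:R * pi / (2 ^ M)%:R : R) ^- 2.
  move=> s c.
  have p0 : (2 ^ M)%:R != 0 :> R by rewrite pnatr_eq0 expn_eq0.
  split.
    rewrite big_nat_rev/=; apply: eq_big_nat => k /andP[k1 k2]; congr (_ ^- 2).
    rewrite add1n subSS /s natrB 1?ltnW// -cosBpihalf /c -cosN; congr cos.
    by rewrite expnS natrM; field.
  rewrite -big_split/= mulr_sumr; apply: eq_big_nat => k hk.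
  have /andP[h1 h2] := @dyadic_angle R _ _ hk.
  rewrite sin_inv2D_cos_inv2; first 1 last.
  - by rewrite gt_eqF// sin_gt0_pihalf// h1.
  - by rewrite gt_eqF// cos_gt0_pihalf// h2 (lt_trans _ h1)// oppr_lt0 divr_gt0 ?pi_gt0.
  by congr (_ * sin _ ^- 2); rewrite expnS natrM; field.
split; last by have [e1 e2] := half N; lra.
elim: N => [|N IH]; first by rewrite !expn0 big_geq// subrr mul0r.
have [_ e2] := half N.
(* The sum is cut at the midpoint [2 ^ N], whose angle pi/2 contributes the term 1. Shifting the
   upper half by pi/2 turns its sines into cosines. *)
rewrite (@big_cat_nat _ _ _ (2 ^ N))/= ?expn_gt0// ?leq_exp2l//.
rewrite [X in _ + X](@big_cat_nat _ _ _ (2 ^ N).+1)//=; last first.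
  by rewrite expnS mul2n -addnn -addn1 leq_add2l expn_gt0.
rewrite big_nat1.
have -> : \sum_((2 ^ N).+1 <= k < 2 ^ N.+1)
   sin (k%:R * pi / (2 ^ N.+1)%:R : R) ^- 2 =
   \sum_(1 <= k < 2 ^ N) cos (k%:R * pi / (2 ^ N.+1)%:R : R) ^- 2.
  rewrite -add1n big_addn expnS mul2n -addnn addnK; apply: eq_big_nat => k _.
  rewrite -sinDpihalf; congr (sin _ ^- 2).
  rewrite addnn -mul2n natrM natrD; field.
  by rewrite pnatr_eq0 expn_eq0.
have -> : (2 ^ N)%:R * pi / (2 ^ N.+1)%:R = pi / 2 :> R.
  by rewrite expnS natrM; field; rewrite pnatr_eq0 expn_eq0.
rewrite sin_pihalf expr1n invr1 addrCA e2 IH (expnS 4) natrM; field.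
all: by rewrite ?expn_gt0 ?leq_exp2l.
Qed.

(** Cauchy's argument on a dyadic grid: [sin x <= x] turns the exact value of the sum of sin^-2 into
    a bound for the sum of k^-2. Lengthening the sum to a dyadic range only adds nonnegative
    terms. *)
Lemma inv_sq_sum_le (R : realType) (K : nat) :
  \sum_(1 <= k < K.+1) (k%:R ^- 2 : R) <= pi ^+ 2 / 6.
Proof.
have pi0 := pi_gt0 R.
apply: (@le_trans _ _ (\sum_(1 <= k < 2 ^ K.+1) (k%:R ^- 2 : R))).
  rewrite [leRHS](@big_cat_nat _ _ _ K.+1)//=; last by rewrite ltnW// ltn_expl.
  by rewrite lerDl sumr_ge0// => i _; rewrite invr_ge0 exprn_ge0.
set N := K.+1.
have p0 : 0 < (2 ^ N)%:R :> R by rewrite ltr0n expn_gt0.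
have [_ e] := @sum_sin_inv2 R N.
have H : \sum_(1 <= k < 2 ^ N) ((2 ^ N.+1)%:R / pi) ^+ 2 * (k%:R ^- 2 : R) <=
    2 * ((4 ^ N)%:R - 1) / 3.
  rewrite -e; apply: ler_sum_nat => k hk.
  have /andP[h1 h2] := @dyadic_angle R _ _ hk.
  have k0 : 0 < k%:R :> R by case/andP: hk => k0 _; rewrite ltr0n.
  have -> : ((2 ^ N.+1)%:R / pi) ^+ 2 * k%:R ^- 2 = (k%:R * pi / (2 ^ N.+1)%:R) ^- 2 :> R.
    have : (2 ^ N.+1)%:R != 0 :> R by rewrite pnatr_eq0 expn_eq0.
    have := gt_eqF k0; have := gt_eqF pi0.
    move: (2 ^ N.+1)%:R k%:R pi => a b c /negbT c0 /negbT b0 a0.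
    by field; rewrite a0 b0 c0.
  have s0 : 0 < sin (k%:R * pi / (2 ^ N.+1)%:R : R) by rewrite sin_gt0_pihalf// h1.
  rewrite lef_pV2 ?posrE ?exprn_gt0//.
  by apply: lerXn2r; rewrite ?nnegrE ?sin_le_id// ltW.
rewrite -mulr_sumr in H.
have e4 : (4 ^ N)%:R = (2 ^ N)%:R ^+ 2 :> R by rewrite -natrX -expnM mulnC expnM.
move: H; rewrite e4 expnS natrM; set s := \sum_(_ <= _ < _) _; set a := (2 ^ N)%:R in p0 *.
move=> H.
have {}H : (2 * a / pi) ^+ 2 * s <= (2 * a / pi) ^+ 2 * (pi ^+ 2 / 6).
  apply: (le_trans H).
  have -> : (2 * a / pi) ^+ 2 * (pi ^+ 2 / 6) = 2 * a ^+ 2 / 3.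
    by move: pi (gt_eqF pi0) => c /negbT c0; field.
  lra.
by move: H; rewrite ler_pM2l// exprn_gt0// divr_gt0// mulr_gt0.
Qed.

(** * Euler's product *)

Lemma is_derive_ln_series (R : realType) (M : nat) (t : R) :
  is_derive t 1 (fun t : R => \sum_(1 <= k < M.+1) t ^+ k / k%:R) (\sum_(k < M) t ^+ k).
Proof.
elim: M => [|M IH].
  rewrite big_ord0.
  have -> : (fun t : R => \sum_(1 <= k < 1) t ^+ k / k%:R) = cst 0 :> (R -> R).
    by apply/funext => y; rewrite big_geq.
  exact: is_derive_cst.
have -> : (fun t : R => \sum_(1 <= k < M.+2) t ^+ k / k%:R) =
    (fun t : R => \sum_(1 <= k < M.+1) t ^+ k / k%:R) \+
    (fun t => M.+1%:R^-1 * t ^+ M.+1) :> (R -> R).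
  by apply/funext => y; rewrite big_nat_recr//= [X in _ + X]mulrC.
rewrite big_ord_recr/=; apply: is_deriveD.
have D : is_derive t 1 (fun t : R => t ^+ M.+1) (M.+1%:R * t ^+ M).
  apply: DeriveDef; first exact: exprn_derivable.
  by rewrite exp_derive/= [LHS]mulr1.
have -> : t ^+ M = M.+1%:R^-1 *: (M.+1%:R * t ^+ M) by rewrite /GRing.scale/= mulKf.
exact: is_deriveZ.
Qed.

(** The partial sum plus ln (1 - t) has derivative - t^M / (1 - t), so the mean value theorem on
    [0, x] controls the remainder. *)
Lemma ln_series_le (R : realType) (M : nat) (x : R) : 0 <= x < 1 ->
  - ln (1 - x) <= \sum_(1 <= k < M.+1) x ^+ k / k%:R + x ^+ M / (1 - x).
Proof.
move=> /andP[x0 x1].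
pose f (t : R) := \sum_(1 <= k < M.+1) t ^+ k / k%:R + ln (1 - t).
pose g (t : R) := \sum_(k < M) t ^+ k - (1 - t)^-1.
have D t : 0 <= t <= x -> is_derive t 1 f (g t).
  move=> /andP[t0 tx]; apply: is_deriveD; first exact: is_derive_ln_series.
  have -> : - (1 - t)^-1 = (1 - t)^-1 * (- 1) by rewrite mulrN1.
  apply: (@is_derive1_comp _ (@ln R) (fun t => 1 - t)).
    by apply: is_derive1_ln; rewrite subr_gt0 (le_lt_trans tx).
  by rewrite -[- 1]add0r; apply: is_deriveB.
have C := is_derive_continuous_within D.
have D' t : t \in `]0, x[ -> is_derive t 1 f (g t).
  by rewrite in_itv/= => /andP[a b]; apply: D; rewrite !ltW.
have [c] := MVT_segment x0 D' C.
rewrite in_itv/= => /andP[c0 cx] e.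
have f0 : f 0 = 0.
  rewrite /f subr0 ln1 addr0 big_nat big1// => k /andP[k0 _].
  by rewrite -(prednK k0) exprS !mul0r.
have c1 : c < 1 by rewrite (le_lt_trans cx).
have gE : g c = - (c ^+ M / (1 - c)).
  have := subrX1 c M; rewrite /g.
  have n0 : 1 - c != 0 by rewrite gt_eqF// subr_gt0.
  set S := \sum_(_ < _) _ => h.
  apply: (mulfI n0); rewrite mulrBr mulfV// mulrN mulrCA mulfV// mulr1.
  by move: h; lra.
have B : c ^+ M / (1 - c) <= x ^+ M / (1 - x).
  rewrite ler_pM ?exprn_ge0 ?invr_ge0 ?subr_ge0 ?(ltW c1)//.
    by apply: lerXn2r; rewrite ?nnegrE.
  by rewrite lef_pV2 ?posrE ?subr_gt0// lerB.
move: e; rewrite f0 !subr0 gE /f => e.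
have h1 : c ^+ M / (1 - c) * x <= x ^+ M / (1 - x).
  rewrite -[leRHS]mulr1 ler_pM// ?(ltW x1)// divr_ge0 ?exprn_ge0// subr_ge0 ltW//.
by move: e h1; rewrite mulNr; lra.
Qed.

(** With q = r^2, pairing q^i with q^(k-i) and using a^2 + b^2 >= 2ab shows that 1, q, ..., q^k have
    mean at least q^(k/2) = r^k. Working with r keeps this exponent integral. *)
Lemma one_sub_expr_ge (R : realType) (r : R) (k : nat) : 0 <= r ->
  r <= 1 -> (1 - r ^+ 2) * (k.+1%:R * r ^+ k) <= 1 - (r ^+ 2) ^+ k.+1.
Proof.
move=> r0 r1.
have -> : 1 - (r ^+ 2) ^+ k.+1 = (1 - r ^+ 2) * \sum_(i < k.+1) (r ^+ 2) ^+ i.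
  by rewrite -opprB subrX1 -mulNr opprB.
rewrite ler_wpM2l ?subr_ge0 ?exprn_ile1//.
have E : \sum_(i < k.+1) (r ^+ 2) ^+ i = \sum_(i < k.+1) (r ^+ 2) ^+ (k - i).
  by rewrite (reindex_inj rev_ord_inj)/=; apply: eq_bigr => i _; rewrite subSS.
suff : 2 * (k.+1%:R * r ^+ k) <= 2 * \sum_(i < k.+1) (r ^+ 2) ^+ i by lra.
rewrite [leRHS]mulrDl !mul1r {1}E -big_split/=.
have -> : 2 * (k.+1%:R * r ^+ k) = \sum_(i < k.+1) 2 * r ^+ k.
  by rewrite sumr_const card_ord -[in RHS]mulr_natl; ring.
apply: ler_sum => i _.
have ik : (i <= k)%N by rewrite -ltnS.
rewrite -!exprM ![(2 * _)%N]mulnC !exprM -[in leLHS](subnK ik) exprD -subr_ge0.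
have -> : (r ^+ (k - i)) ^+ 2 + (r ^+ i) ^+ 2 - 2 * (r ^+ (k - i) * r ^+ i) =
   (r ^+ (k - i) - r ^+ i) ^+ 2 by ring.
exact: sqr_ge0.
Qed.

(** A geometric sum of ratio x = r^(2(k+1)), where 1 - x is bounded below by [one_sub_expr_ge]. The
    factor r^(k+1) kept on the right leads to Li_2(r) rather than to zeta(2), and this gap yields
    the factor (1 - rho)^(1/2) in Euler's product. *)
Lemma geometric_lambert (R : realType) (r : R) (k K : nat) : 0 < r < 1 ->
  \sum_(1 <= j < K.+1) (r ^+ 2) ^+ (j * k.+1) <= r ^+ k.+1 / ((1 - r ^+ 2) * k.+1%:R).
Proof.
move=> /andP[r0 r1].
have e0 : 0 < 1 - r ^+ 2 by rewrite subr_gt0 exprn_ilt1 ?ltW.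
set x := (r ^+ 2) ^+ k.+1.
have x1 : 0 < 1 - x by rewrite subr_gt0 /x -exprM exprn_ilt1// ltW.
have x0 : 0 <= x by rewrite /x !exprn_ge0// ltW.
apply: (@le_trans _ _ (x / (1 - x))).
  rewrite ler_pdivlMr//.
  have -> : \sum_(1 <= j < K.+1) (r ^+ 2) ^+ (j * k.+1) = x * \sum_(j < K) x ^+ j.
    rewrite big_add1/= big_mkord mulr_sumr; apply: eq_bigr => j _.
    by rewrite mulnC exprM exprS.
  rewrite -mulrA -opprB mulrN [_ * (x - 1)]mulrC -subrX1 opprB.
  by rewrite ler_piMr// gerBl exprn_ge0.
rewrite ler_pdivrMr// mulrAC ler_pdivlMr ?mulr_gt0//.
have H := @one_sub_expr_ge R r k (ltW r0) (ltW r1).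
apply: (@le_trans _ _ (r ^+ k.+1 * ((1 - r ^+ 2) * (k.+1%:R * r ^+ k)))); last first.
  by rewrite ler_wpM2l// exprn_ge0// ltW.
rewrite {1}/x -exprM mulnC exprM expr2 (exprS r k) .
have : 0 <= r ^+ k by rewrite exprn_ge0// ltW.
move: (r ^+ k) => y y0.
have -> : (r * y * ((1 - r ^+ 2) * (k.+1%:R * y))) = (r * y * y) * ((1 - r ^+ 2) * k.+1%:R) by ring.
rewrite ler_wpM2r// ?mulr_ge0 ?(ltW e0)//.
by rewrite ler_wpM2l ?mulr_ge0 ?(ltW r0)// ler_piMl// ltW.
Qed.

(* an Abel summation standing for Euler's reflection formula
   Li_2(r) + Li_2(1-r) = pi^2/6 - ln r ln (1-r) *)
Lemma dilog_reflection_ge (R : realType) (r : R) (M : nat) : 0 <= r <= 1 ->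
  (1 - r) * \sum_(1 <= k < M.+1) r ^+ k / k%:R - M.+1%:R^-1 <=
  \sum_(1 <= k < M.+1) (1 - r ^+ k) / k%:R ^+ 2.
Proof.
move=> /andP[r0 r1].
(* The induction carries the boundary term of the Abel summation. The only loss at each step is
   1/(M+1) - 1/(M+2) <= 1/(M+1)^2. *)
have H : (1 - r) * \sum_(1 <= k < M.+1) r ^+ k.-1 / k%:R - (1 - r ^+ M) / M.+1%:R <=
    \sum_(1 <= k < M.+1) (1 - r ^+ k) / k%:R ^+ 2.
  elim: M => [|M IH]; first by rewrite !big_geq//; lra.
  rewrite [in leLHS](big_nat_recr M.+1)//= [in leRHS](big_nat_recr M.+1)//=.
  set s := \sum_(_ <= _ < _) _ in IH *; set t := \sum_(_ <= _ < _) _ in IH *.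
  have x1 : 0 <= 1 - r ^+ M.+1 by rewrite subr_ge0 exprn_ile1.
  have h : (1 - r ^+ M.+1) / M.+1%:R - (1 - r ^+ M.+1) / M.+2%:R <=
      (1 - r ^+ M.+1) / M.+1%:R ^+ 2.
    rewrite -mulrBr ler_wpM2l//.
    have -> : M.+1%:R^-1 - M.+2%:R^-1 = (M.+1%:R * M.+2%:R)^-1 :> R.
      have : M.+1%:R != 0 :> R by rewrite pnatr_eq0.
      have : M.+2%:R != 0 :> R by rewrite pnatr_eq0.
      by rewrite -[M.+2]addn1 natrD; move: M.+1%:R => a a1 a0; field; rewrite a0 a1.
    by rewrite lef_pV2 ?posrE// ?mulr_gt0 ?exprn_gt0// expr2 ler_wpM2l// ler_nat.
  have e : (1 - r) * (r ^+ M / M.+1%:R) + (1 - r ^+ M) / M.+1%:R =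
      (1 - r ^+ M.+1) / M.+1%:R by rewrite exprS; ring.
  apply: le_trans (lerD IH h); rewrite -e le_eqVlt; apply/orP; left; apply/eqP.
  ring.
apply: le_trans H; apply: lerB.
  rewrite ler_wpM2l ?subr_ge0//; apply: ler_sum_nat => k /andP[k0 _].
  by rewrite ler_wpM2r// -{1}(prednK k0) exprS ler_piMl// exprn_ge0.
by rewrite ler_piMl// gerBl exprn_ge0.
Qed.

Lemma le_lim0 (R : realType) (a b : R) (e : nat -> R) :
  e @ \oo --> (0 : R) -> (forall M, a <= b + e M) -> a <= b.
Proof.
move=> e0 H; have : (fun M => b + e M) @ \oo --> b + 0 by apply: cvgD => //; exact: cvg_cst.
rewrite addr0 => c; rewrite -(cvg_lim _ c)//.
apply: limr_ge; first by apply/cvg_ex; exists b.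
exact: nearW.
Qed.

(** Expanding each logarithm and exchanging the sums leaves (sum_k r^k / k^2) / (1 - rho) with r =
    sqrt rho. This is a partial sum of zeta(2) minus the sum bounded below by
    [dilog_reflection_ge]. *)
Lemma sum_ln_euler_le (R : realType) (rho : R) (K : nat) : 0 < rho < 1 ->
  - (\sum_(1 <= j < K.+1) ln (1 - rho ^+ j)) <=
  pi ^+ 2 / 6 / (1 - rho) + ln (1 - rho) / 2.
Proof.
move=> /andP[rho0 rho1].
pose r := Num.sqrt rho.
have rE : rho = r ^+ 2 by rewrite sqr_sqrtr// ltW.
have r0 : 0 < r by rewrite sqrtr_gt0.
have r1 : r < 1 by rewrite -(sqrtr1 R) ltr_sqrt.
have e0 : 0 < 1 - rho by rewrite subr_gt0.
set ep := 1 - rho in e0 *.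
(* Here [M] is the order at which the logarithmic series are cut. For fixed [K] the last group of
   terms vanishes as [M] grows. *)
have main M : - (\sum_(1 <= j < K.+1) ln (1 - rho ^+ j)) <=
    (pi ^+ 2 / 6 + (1 - r) * ln (1 - r)) / ep +
    (r ^+ M + M.+1%:R^-1 + K%:R * rho ^+ M) / ep.
  have s1 : - (\sum_(1 <= j < K.+1) ln (1 - rho ^+ j)) <=
     \sum_(1 <= j < K.+1) \sum_(1 <= k < M.+1) rho ^+ (j * k) / k%:R +
     K%:R * rho ^+ M / ep.
    rewrite -sumrN.
    apply: (@le_trans _ _ (\sum_(1 <= j < K.+1)
       (\sum_(1 <= k < M.+1) rho ^+ (j * k) / k%:R + rho ^+ M / ep))); last first.
      rewrite big_split/= lerD2l sumr_const_nat subn1/= -[leLHS]mulr_natl; lra.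
    apply: ler_sum_nat => j /andP[j0 _].
    have x1 : 0 <= rho ^+ j < 1 by rewrite exprn_ge0 ?exprn_ilt1 ?(ltW rho0)// -lt0n.
    apply: le_trans (@ln_series_le R M _ x1) _; apply: lerD.
      by rewrite le_eqVlt; apply/orP; left; apply/eqP; apply: eq_bigr => k _; rewrite exprM.
    have le_rho : rho ^+ j <= rho by rewrite -[leRHS]expr1 ler_wiXn2l ?(ltW rho0) ?(ltW rho1).
    apply: ler_pM; rewrite ?exprn_ge0 ?invr_ge0 ?subr_ge0 ?(ltW rho0)//.
    - by case/andP: x1 => _ /ltW.
    - by apply: lerXn2r; rewrite ?nnegrE ?exprn_ge0 ?(ltW rho0).
    - by rewrite lef_pV2 ?posrE ?subr_gt0 ?lerD2l ?lerN2//; case/andP: x1.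
  have s2 : \sum_(1 <= j < K.+1) \sum_(1 <= k < M.+1) rho ^+ (j * k) / k%:R <=
     (\sum_(1 <= k < M.+1) r ^+ k / k%:R ^+ 2) / ep.
    rewrite exchange_big/= mulr_suml; apply: ler_sum_nat => k /andP[k0 _].
    rewrite -mulr_suml -(prednK k0) rE.
    have r01 : 0 < r < 1 by rewrite r0.
    apply: le_trans (ler_wpM2r _ (@geometric_lambert R r k.-1 K r01)) _ => //.
    rewrite -rE -/ep le_eqVlt; apply/orP; left; apply/eqP.
    have : k.-1.+1%:R != 0 :> R by rewrite pnatr_eq0.
    have /negbT := gt_eqF e0.
    move: (ep) k.-1.+1%:R => a b /= a1 b1; field; by rewrite a1.
  have s3 : \sum_(1 <= k < M.+1) r ^+ k / k%:R ^+ 2 =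
     \sum_(1 <= k < M.+1) (k%:R ^- 2) - \sum_(1 <= k < M.+1) (1 - r ^+ k) / k%:R ^+ 2.
    rewrite -sumrB; apply: eq_bigr => k _; ring.
  have s4 := @inv_sq_sum_le R M.
  have r01 : 0 <= r <= 1 by rewrite !ltW.
  have s5 := @dilog_reflection_ge R r M r01.
  have r01' : 0 <= r < 1 by rewrite ltW.
  have s6 := @ln_series_le R M r r01'.
  apply: (le_trans s1); apply: (le_trans (lerD s2 (lexx _))).
  rewrite s3 -!mulrDl ler_pM2r ?invr_gt0//.
  have nr : 0 < 1 - r by rewrite subr_gt0.
  have s7 : (1 - r) * - ln (1 - r) - r ^+ M <=
     (1 - r) * \sum_(1 <= k < M.+1) r ^+ k / k%:R.
    have := ler_wpM2l (ltW nr) s6; rewrite mulrDr.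
    have -> : (1 - r) * (r ^+ M / (1 - r)) = r ^+ M by rewrite mulrC mulfVK// gt_eqF.
    lra.
  rewrite mulrN in s7; move: s4 s5 s7.
  move: (\sum_(1 <= k < M.+1) k%:R ^- 2) (\sum_(1 <= k < M.+1) (1 - r ^+ k) / k%:R ^+ 2).
  move: ((1 - r) * \sum_(1 <= k < M.+1) r ^+ k / k%:R) (M.+1%:R^-1) (pi ^+ 2 / 6).
  move: (ln (1 - r)) (r ^+ M) (K%:R * rho ^+ M) => l i p A B D x y.
  lra.
have lim : - (\sum_(1 <= j < K.+1) ln (1 - rho ^+ j)) <=
    (pi ^+ 2 / 6 + (1 - r) * ln (1 - r)) / ep.
  apply: le_lim0 main.
  rewrite -[X in _ --> X](mul0r (ep^-1)); apply: cvgMl.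
  rewrite -[X in _ --> X]addr0 -[X in _ --> X + _]addr0; apply: cvgD; first apply: cvgD.
  - by apply: cvg_expr; rewrite ger0_norm// ltW.
  - exact: cvg_harmonic.
  - rewrite -[X in _ --> X](mulr0 K%:R); apply: cvgMr.
    by apply: cvg_expr; rewrite ger0_norm// ltW.
apply: (le_trans lim); rewrite mulrDl lerD2l.
(* Since [ep = (1 - r) * (1 + r)], the remaining term is ln (1 - r) / (1 + r). The logarithms are
   negative and 1 <= 1 + r <= 2, whence the bound ln ep / 2. *)
have epE : ep = (1 - r) * (1 + r) by rewrite /ep rE; ring.
have nr : 0 < 1 - r by rewrite subr_gt0.
have pr : 0 < 1 + r by rewrite addr_gt0.
have lep : ln ep <= 0 by apply: ln_le0; rewrite gerBl ltW.
rewrite {1}epE.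
have -> : (1 - r) * ln (1 - r) / ((1 - r) * (1 + r)) = ln (1 - r) / (1 + r).
  by rewrite -mulf_div mulfV ?gt_eqF// mul1r.
have l1 : ln (1 - r) <= ln ep.
  rewrite ler_ln ?posrE// epE ler_peMr ?(ltW nr)//; lra.
rewrite ler_pdivrMr//; apply: (le_trans l1).
have : 0 <= (1 - r) * (- ln ep) by apply: mulr_ge0; rewrite ?oppr_ge0// ltW.
lra.
Qed.

(** * Hitting probabilities of the biased walk *)

Section gambler.
Variables (R : realType) (p : R).

(* [ruin r j] is the probability that the walk reaches [- j] within r steps *)
Fixpoint ruin (r j : nat) : R :=
  match j, r with
  | 0%N, _ => 1
  | _.+1, 0%N => 0
  | j'.+1, r'.+1 => p * ruin r' j'.+2 + (1 - p) * ruin r' j'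
  end.

Hypotheses (p0 : 0 < p) (p1 : p < 1).

Lemma ruin_ge0 r j : 0 <= ruin r j.
Proof.
elim: r j => [|r IH] [|j] //=.
by apply: addr_ge0; apply: mulr_ge0; rewrite ?subr_ge0// ltW.
Qed.

(** Under the last hypothesis [x ^+ j] is a supersolution of the recursion, and it dominates [ruin]
    at time 0. *)
Lemma ruin_le r j x : 0 <= x -> x <= 1 -> p * x ^+ 2 + (1 - p) <= x -> ruin r j <= x ^+ j.
Proof.
move=> x0 x1 hx; elim: r j => [|r IH] [|j] //=.
  by rewrite exprn_ge0.
apply: (@le_trans _ _ (p * x ^+ j.+2 + (1 - p) * x ^+ j)).
  by apply: lerD; apply: ler_wpM2l; rewrite ?subr_ge0// ltW.
have := ler_wpM2r (exprn_ge0 j x0) hx; rewrite !exprS; lra.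
Qed.

(* The error lam^r y^j is carried by an exponential supersolution of the recursion. *)
Lemma ruin_ge r j x y lam : 0 <= x -> x <= y -> y <= 1 -> 0 <= lam ->
  x <= p * x ^+ 2 + (1 - p) -> p * y ^+ 2 + (1 - p) <= lam * y ->
  x ^+ j - lam ^+ r * y ^+ j <= ruin r j.
Proof.
move=> x0 xy y1 l0 hx hy; have y0 := le_trans x0 xy.
elim: r j => [|r IH] [|j] /=.
- by rewrite !expr0; lra.
- by rewrite mul1r subr_le0; apply: lerXn2r; rewrite ?nnegrE.
- by rewrite expr0 mulr1 lerBlDr lerDl exprn_ge0.
apply: (@le_trans _ _ (p * (x ^+ j.+2 - lam ^+ r * y ^+ j.+2) +
   (1 - p) * (x ^+ j - lam ^+ r * y ^+ j))); last first.
  by apply: lerD; apply: ler_wpM2l; rewrite ?subr_ge0// ltW.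
have h1 := ler_wpM2r (exprn_ge0 j x0) hx.
have h2 := ler_wpM2r (mulr_ge0 (exprn_ge0 r l0) (exprn_ge0 j y0)) hy.
move: h1 h2; rewrite !exprS; lra.
Qed.
End gambler.

(** * Events depending on finitely many independent bits *)

Section real_probability.
Context d (T : measurableType d) (R : realType) (P : probability T R).
Implicit Types A B E : set T.

Definition prob E : R := fine (P E).

Lemma probE E : measurable E -> P E = (prob E)%:E.
Proof. by move=> mE; rewrite fineK// fin_num_measure. Qed.

Lemma prob_ge0 E : 0 <= prob E.
Proof. exact: fine_ge0. Qed.

Lemma probT : prob setT = 1.
Proof. by rewrite /prob probability_setT. Qed.

Lemma prob0 : prob set0 = 0.
Proof. by rewrite /prob measure0. Qed.

Lemma prob_le A B : measurable A -> measurable B -> A `<=` B -> prob A <= prob B.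
Proof.
by move=> mA mB AB; rewrite -lee_fin -!probE//; apply: le_measure; rewrite ?inE.
Qed.

Lemma prob_le1 A : measurable A -> prob A <= 1.
Proof. by move=> mA; rewrite -probT; apply: prob_le. Qed.

Lemma prob_disjointU A B : measurable A -> measurable B -> A `&` B = set0 ->
  prob (A `|` B) = prob A + prob B.
Proof.
move=> mA mB AB; apply: EFin_inj.
by rewrite EFinD -!probE ?measureU//; exact: measurableU.
Qed.

Lemma prob_le_cover A B E : measurable A -> measurable B -> measurable E ->
  E `<=` A `|` B -> prob E <= prob A + prob B.
Proof.
move=> mA mB mE EAB; apply: (@le_trans _ _ (prob (A `|` B))).
  by apply: prob_le => //; exact: measurableU.
by rewrite -lee_fin EFinD -!probE ?measureU2//; exact: measurableU.
Qed.

Lemma prob_setD A B : measurable A -> measurable B -> B `<=` A ->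
  prob (A `\` B) = prob A - prob B.
Proof.
move=> mA mB BA.
have -> : prob A = prob (A `\` B) + prob B; last by lra.
rewrite -prob_disjointU//; first by rewrite setDKU.
- exact: measurableD.
- by rewrite setDE -setIA setICl setI0.
Qed.
End real_probability.

Section independent_bits.
Context d (T : measurableType d) (R : realType) (P : probability T R).
Context (I : choiceType) (X : I -> {mfun T >-> bool}).
Hypothesis indX : mutually_independent P X.
Implicit Types (l : seq I) (E : set T) (J : {fset I}) (A : I -> set bool).

Local Notation pr := (prob P).

Definition depends l E := forall w w',
  (forall a, a \in l -> X a w = X a w') -> E w -> E w'.

Let measurable_bool (B : set bool) : measurable B.
Proof. by []. Qed.

Let measurable_bit a B : measurable (X a @^-1` B).
Proof. by rewrite -[X in measurable X]setTI; exact: measurable_funP. Qed.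

(** The section of [E] at the value [b] of the bit [a], saturated under the bits of [l] so that it
    depends on [l] alone. *)
Let slice E a l b : set T :=
  [set w | exists w', [/\ E w', X a w' = b & forall i, i \in l -> X i w' = X i w]].

Let depends_slice E a l b : depends l (slice E a l b).
Proof.
move=> w w' ww' [v [Ev vb vw]]; exists v; split=> // i il.
by rewrite vw ?ww'.
Qed.

Let slice_split E a l : depends (a :: l) E ->
  E = (X a @^-1` [set true] `&` slice E a l true) `|`
      (X a @^-1` [set false] `&` slice E a l false).
Proof.
move=> dE; apply/seteqP; split=> [w Ew|w].
  by case e : (X a w); [left|right]; (split; first by []); exists w.
by case=> -[wb [v [Ev vb vw]]]; apply: (dE v) => // i; rewrite inE => /orP[/eqP ->|/vw//];
  rewrite wb vb.
Qed.

(** Splitting on one bit at a time reduces to an event depending on no bit, which is empty or the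
    whole space. *)
Lemma depends_measurable l E : depends l E -> measurable E.
Proof.
elim: l E => [|a l IH] E dE.
  have [[w Ew]|/set0P/negP] := pselect (E !=set0); last by rewrite negbK => /eqP ->.
  suff -> : E = setT by [].
  by apply/seteqP; split=> // w' _; apply: (dE w).
rewrite (slice_split dE); apply: measurableU; apply: measurableI => //;
  apply: IH; exact: depends_slice.
Qed.

Let rect J A : set T := \bigcap_(j in [set` J]) (X j @^-1` A j).

Let measurable_rect J A : measurable (rect J A).
Proof. by apply: fin_bigcap_measurable => //; exact: finite_fset. Qed.

Let upd A a b : I -> set bool := fun i => if i == a then [set b] else A i.

Let rect_cons J A a b : a \notin J ->
  rect (a |` J)%fset (upd A a b) = X a @^-1` [set b] `&` rect J A.
Proof.
move=> aJ; apply/seteqP; split=> w.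
  move=> H; split; first by have := H a; rewrite /upd eqxx; apply; rewrite /= fset1U1.
  move=> j /= jJ; have := H j; rewrite /upd /= in_fset1U jJ orbT => /(_ isT).
  by case: eqP => // ja; move: aJ; rewrite -ja jJ.
move=> [wb H] j /=; rewrite in_fset1U => /orP[/eqP ->|jJ]; rewrite /upd ?eqxx//.
by case: eqP => [->//|_]; exact: H.
Qed.

Let pr_rect_cons J A a b : a \notin J ->
  pr (X a @^-1` [set b] `&` rect J A) = pr (X a @^-1` [set b]) * pr (rect J A).
Proof.
move=> aJ; rewrite -rect_cons//; apply: EFin_inj.
rewrite EFinM -!probE// /rect !indX// big_fsetU1//= /upd eqxx; congr (_ * _)%E.
by apply: eq_big_seq => j jJ; case: eqP => // ja; move: aJ; rewrite -ja jJ.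
Qed.

Let pr_split E a l J A : depends (a :: l) E ->
  pr (rect J A `&` E) =
  pr (X a @^-1` [set true] `&` rect J A `&` slice E a l true) +
  pr (X a @^-1` [set false] `&` rect J A `&` slice E a l false).
Proof.
move=> dE; have mS b := depends_measurable (@depends_slice E a l b).
rewrite -prob_disjointU.
- congr (prob _ _); rewrite {1}(slice_split dE) setIUr.
  by rewrite !setIA; congr (_ `&` _ `|` _ `&` _); rewrite setIC.
- by do ! apply: measurableI.
- by do ! apply: measurableI.
- apply/seteqP; split=> // w [[[/= h1 _] _] [[/= h2 _] _]].
  by rewrite h1 in h2.
Qed.

(** The cylinder [rect J A] is an accumulator: each bit of [l] is moved into it in turn, until only
    the product formula for cylinders is left. *)
Let pr_rectI E l J A : uniq l -> (forall a, a \in l -> a \notin J) -> depends l E ->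
  pr (rect J A `&` E) = pr (rect J A) * pr E.
Proof.
elim: l E J A => [|a l IH] E J A.
  move=> _ _ dE; have [[w Ew]|/set0P/negP] := pselect (E !=set0).
    suff -> : E = setT by rewrite setIT probT mulr1.
    by apply/seteqP; split=> // w' _; apply: (dE w).
  by rewrite negbK => /eqP ->; rewrite setI0 prob0 mulr0.
move=> /= /andP[al ul] lJ dE.
have aJ : a \notin J by apply: lJ; rewrite mem_head.
have step b K B : a \notin K -> (forall i, i \in l -> i \notin K) ->
   pr (X a @^-1` [set b] `&` rect K B `&` slice E a l b) =
   pr (X a @^-1` [set b]) * pr (rect K B) * pr (slice E a l b).
  move=> aK lK; rewrite -pr_rect_cons// -rect_cons// IH//.
  move=> i il; rewrite in_fset1U negb_or lK// andbT.
  by apply: contraNneq al => <-.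
have lJ' i : i \in l -> i \notin J by move=> il; apply: lJ; rewrite inE il orbT.
rewrite (pr_split _ _ dE) !step//.
have -> : pr E = pr (rect fset0 A `&` E).
  by congr (prob _ _); rewrite /rect set_fset0 bigcap_set0 setTI.
rewrite (pr_split _ _ dE) !step//.
have -> : pr (rect fset0 A) = 1 by rewrite /rect set_fset0 bigcap_set0 probT.
by ring.
Qed.

Lemma depends_indep l1 l2 E1 E2 : uniq (l1 ++ l2) -> depends l1 E1 -> depends l2 E2 ->
  pr (E1 `&` E2) = pr E1 * pr E2.
Proof.
move=> u d1 d2.
have ul2 : uniq l2 by move: u; rewrite cat_uniq => /and3P[].
(* The same accumulation, now over the bits of [l1]. The base case is [pr_rectI] for [E2], and the
   claim is the case of an empty cylinder. *)
suff main J A : (forall a, a \in l1 ++ l2 -> a \notin J) ->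
    pr (rect J A `&` E1 `&` E2) = pr (rect J A `&` E1) * pr E2.
  have := main fset0 (fun _ => setT) (fun _ _ => erefl).
  by rewrite /rect set_fset0 bigcap_set0 !setTI.
elim: l1 E1 d1 u J A => [|a l IH] E1 d1 u J A dis.
  have [[w Ew]|/set0P/negP] := pselect (E1 !=set0).
    suff -> : E1 = setT by rewrite !setIT (pr_rectI _ ul2).
    by apply/seteqP; split=> // w' _; apply: (d1 w).
  by rewrite negbK => /eqP ->; rewrite setI0 set0I prob0 mul0r.
have mE2 := depends_measurable d2.
have mS b := depends_measurable (@depends_slice E1 a l b).
move: u => /= /andP[al u].
have aJ : a \notin J by apply: dis; rewrite mem_head.
rewrite (pr_split _ _ d1) -!rect_cons// mulrDl.
have disU b : forall i, i \in l ++ l2 -> i \notin (a |` J)%fset.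
  move=> i il; rewrite in_fset1U negb_or dis ?andbT; last by rewrite inE il orbT.
  by apply: contraNneq al => <-.
rewrite -!IH//; try exact: depends_slice; try by move=> ?; exact: disU.
rewrite !rect_cons//.
rewrite -prob_disjointU.
- congr (prob _ _); rewrite {1}(slice_split d1) -setIUl; congr (_ `&` _).
  by rewrite setIUr !setIA; congr (_ `&` _ `|` _ `&` _); rewrite setIC.
- by do ! apply: measurableI.
- by do ! apply: measurableI.
- apply/seteqP; split=> // w [[[[/= h1 _] _] _] [[[/= h2 _] _] _]].
  by rewrite h1 in h2.
Qed.
End independent_bits.

(** * Independence of events with disjoint supports *)

Section local_events.
Context d (T : measurableType d) (R : realType) (P : probability T R).
Context (I : choiceType) (X : I -> {mfun T >-> bool}).
Implicit Types (Q : set I) (E : set T).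

(** [Q] may be infinite, for instance all bits of all frogs in a half-line, while the event uses
    finitely many of them. Independence then reduces to disjointness of two sets of indices. *)
Definition local Q E := exists2 l : seq I, (forall a, a \in l -> Q a) & depends X l E.

Lemma local_sub Q Q' E : Q `<=` Q' -> local Q E -> local Q' E.
Proof. by move=> QQ' [l lQ dE]; exists l => // a /lQ /QQ'. Qed.

Lemma localC Q E : local Q E -> local Q (~` E).
Proof.
move=> [l lQ dE]; exists l => // w w' ww' nE Ew'; apply: nE.
by apply: dE Ew' => a al; rewrite ww'.
Qed.

Lemma localT Q : local Q setT.
Proof. by exists [::]. Qed.

Lemma localI Q E E' : local Q E -> local Q E' -> local Q (E `&` E').
Proof.
move=> [l lQ dE] [l' lQ' dE']; exists (l ++ l').
  by move=> a; rewrite mem_cat => /orP[/lQ|/lQ'].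
move=> w w' ww' [Ew E'w]; split.
  by apply: dE Ew => a al; rewrite ww'// mem_cat al.
by apply: dE' E'w => a al; rewrite ww'// mem_cat al orbT.
Qed.

Lemma localD Q E E' : local Q E -> local Q E' -> local Q (E `\` E').
Proof. by move=> lE lE'; rewrite setDE; apply: localI => //; exact: localC. Qed.

Lemma local_measurable Q E : local Q E -> measurable E.
Proof. by move=> [l _]; exact: depends_measurable. Qed.

Hypothesis indX : mutually_independent P X.

Lemma local_indep Q Q' E E' : Q `&` Q' = set0 -> local Q E -> local Q' E' ->
  prob P (E `&` E') = prob P E * prob P E'.
Proof.
move=> QQ' [l lQ dE] [l' lQ' dE'].
apply: (@depends_indep _ _ _ _ _ X indX (undup l) (undup l')).
- rewrite cat_uniq !undup_uniq /= andbT; apply/hasPn => a.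
  rewrite mem_undup => al'; apply/negP => a_l.
  have al : a \in l by rewrite -mem_undup.
  have : (Q `&` Q') a by split; [exact: lQ|exact: lQ'].
  by rewrite QQ'.
- by move=> w w' ww'; apply: dE => a al; apply: ww'; rewrite mem_undup.
- by move=> w w' ww'; apply: dE' => a al; apply: ww'; rewrite mem_undup.
Qed.
End local_events.

(* [hits b r j]: the walk with steps [b 0], [b 1], ... reaches [- j] within r steps. *)
Fixpoint hits (b : nat -> bool) (r j : nat) : bool :=
  match j, r with
  | 0%N, _ => true
  | _.+1, 0%N => false
  | j'.+1, r'.+1 => hits (fun u => b u.+1) r' (if b 0%N then j'.+2 else j')
  end.

Definition walk (b : nat -> bool) (t : nat) : int :=
  \sum_(u < t) (if b u then 1 else - 1).

Lemma walkS b t : walk b t.+1 = (if b 0%N then 1 else - 1) + walk (fun u => b u.+1) t.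
Proof. by rewrite /walk big_ord_recl. Qed.

Lemma hits_walk b r j : hits b r j -> exists2 t, (t <= r)%N & walk b t = - j%:Z.
Proof.
elim: r b j => [|r IH] b [|j] //=; try by exists 0%N => //; rewrite /walk big_ord0.
move=> /IH [t tr e]; exists t.+1 => //.
by rewrite walkS e; case: (b 0%N); lia.
Qed.

(** Unit steps cannot jump over - j, so it is enough to be at or beyond it at some time up to
    [r]. *)
Lemma walk_hits b r t j : (t <= r)%N -> walk b t <= - j%:Z -> hits b r j.
Proof.
elim: r b t j => [|r IH] b t [|j] //=.
  by rewrite leqn0 => /eqP ->; rewrite /walk big_ord0; lia.
case: t => [|t]; first by rewrite /walk big_ord0; lia.
rewrite ltnS walkS => tr h; apply: (IH _ t) => //.
by move: h; case: (b 0%N); lia.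
Qed.

Lemma hits_ext b b' r j : (forall u, (u < r)%N -> b u = b' u) -> hits b r j = hits b' r j.
Proof.
elim: r b b' j => [|r IH] b b' [|j] //= bb'.
by rewrite bb'//; apply: IH => u ur; apply: bb'.
Qed.

Lemma hits_mono b r r' j : (r <= r')%N -> hits b r j -> hits b r' j.
Proof.
elim: r r' b j => [|r IH] [|r'] b [|j] //= rr'.
exact: IH.
Qed.

(** * Covering events *)

Section frog_events.
Context d (T : measurableType d) (R : realType) (P : probability T R).
Context (n : nat) (xi : frog_step n -> {mfun T >-> bool}) (rho : R).
Hypothesis law : frog_law rho P xi.

Local Notation pr := (prob P).
Local Notation p := ((1 + rho)^-1).
Local Notation step := (frog_step n).

Let indX : mutually_independent P xi := law.2.

Let local_bit (a : step) (b : bool) : local xi [set a] (xi a @^-1` [set b]).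
Proof.
exists [:: a]; first by move=> i; rewrite inE => /eqP ->.
by move=> w w' ww' /= <-; rewrite ww'// inE.
Qed.

Lemma prob_bit (a : step) (b : bool) :
  pr (xi a @^-1` [set b]) = if b then p else 1 - p.
Proof.
have t : pr (xi a @^-1` [set true]) = p by rewrite /prob law.1.
case: b => //; rewrite -t -(probT P).
have m b := local_measurable (local_bit a b).
have -> : [set: T] = xi a @^-1` [set true] `|` xi a @^-1` [set false].
  by apply/seteqP; split=> // w _ /=; case: (xi a w); [left|right].
rewrite prob_disjointU//; first by lra.
by apply/seteqP; split=> // w [/= h1 h2]; rewrite h1 in h2.
Qed.

(** The offset [k] skips the first steps of the frog, which lets the walk restart after one step in
    the induction on [r]. *)
Definition frog_hits (x : int) (i : 'I_n) (k r j : nat) : set T :=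
  [set w | hits (fun u => xi (x, i, (k + u)%N) w) r j].

Lemma local_frog_hits x i k r j :
  local xi [set a : step | a.1 = (x, i) /\ (k <= a.2)%N] (frog_hits x i k r j).
Proof.
exists [seq (x, i, (k + u)%N) | u <- iota 0 r].
  by move=> a /mapP[u _ ->] /=; rewrite leq_addr.
move=> w w' ww'; rewrite /frog_hits /=.
rewrite (@hits_ext _ (fun u => xi (x, i, (k + u)%N) w'))// => u ur.
by rewrite ww'//; apply/mapP; exists u => //; rewrite mem_iota.
Qed.

(** First-step analysis: bit [k] is independent of the later ones, which reproduces the recursion of
    [ruin]. *)
Lemma prob_frog_hits x i k r j : pr (frog_hits x i k r j) = ruin p r j.
Proof.
elim: r k j => [|r IH] k [|j] /=.
- by rewrite (_ : frog_hits _ _ _ _ _ = setT) ?probT//; apply/seteqP; split.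
- by rewrite (_ : frog_hits _ _ _ _ _ = set0) ?prob0//; apply/seteqP; split.
- by rewrite (_ : frog_hits _ _ _ _ _ = setT) ?probT//; apply/seteqP; split.
pose B b := xi (x, i, k) @^-1` [set b].
have E : frog_hits x i k r.+1 j.+1 = (B true `&` frog_hits x i k.+1 r j.+2) `|`
    (B false `&` frog_hits x i k.+1 r j).
  have shift w m : hits (fun u => xi (x, i, (k + u.+1)%N) w) r m =
      hits (fun u => xi (x, i, (k.+1 + u)%N) w) r m.
    by apply: hits_ext => u _; rewrite addSnnS.
  apply/seteqP; split=> w; rewrite /frog_hits /B /= addn0 !shift.
    by case: (xi (x, i, k) w) => ?; [left|right].
  by case=> -[->].
have lB b := local_bit (x, i, k) b.
have lF m := local_frog_hits x i k.+1 r m.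
have mB b := local_measurable (lB b).
have mF m := local_measurable (lF m).
have dis : [set (x, i, k)] `&` [set a : step | a.1 = (x, i) /\ (k.+1 <= a.2)%N] = set0.
  by apply/seteqP; split=> // a [-> [_ /=]]; rewrite ltnn.
rewrite E prob_disjointU.
- rewrite (local_indep indX dis (lB _) (lF _)) (local_indep indX dis (lB _) (lF _)).
  by rewrite !IH /B !prob_bit.
- by apply: measurableI; [exact: mB|exact: mF].
- by apply: measurableI; [exact: mB|exact: mF].
- by apply/seteqP; split=> // w [[+ _] [+ _]]; rewrite /B /= => ->.
Qed.

Variable h : nat.

(** The walks are followed whether or not their frogs are ever activated, which makes distinct sites
    independent. The horizon [h] leaves finitely many bits. *)
Definition missed (y : int) (m : nat) : set T :=
  [set w | forall j, (0 < j <= m)%N -> forall i, ~ frog_hits (y + j%:Z) i 0 h j w].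

(** The product u_m with rho^j replaced by its value at the finite horizon [h]. *)
Definition miss_prob (m : nat) : R := \prod_(1 <= j < m.+1) (1 - ruin p h j) ^+ n.

Let site_missed x j m : set T :=
  [set w | forall i : 'I_n, (i < m)%N -> ~ frog_hits x i 0 h j w].

Let site_missedP x j m : (m <= n)%N ->
  local xi [set a : step | a.1.1 = x /\ (a.1.2 < m)%N] (site_missed x j m) /\
  pr (site_missed x j m) = (1 - ruin p h j) ^+ m.
Proof.
elim: m => [|m IH] mn.
  have -> : site_missed x j 0 = setT by apply/seteqP; split.
  by rewrite probT expr0; split=> //; exact: localT.
have [lS pS] := IH (ltnW mn).
pose i := Ordinal mn.
have E : site_missed x j m.+1 = site_missed x j m `&` ~` frog_hits x i 0 h j.
  apply/seteqP; split=> w.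
    by move=> H; split; [move=> k km; apply: H; rewrite ltnS ltnW|exact: H].
  move=> [H Hi] k; rewrite ltnS leq_eqVlt => /orP[/eqP km|]; last exact: H.
  by have -> : k = i by exact/val_inj.
have lF : local xi [set a : step | a.1 = (x, i)] (~` frog_hits x i 0 h j).
  by apply/localC/(local_sub _ (local_frog_hits _ _ _ _ _)) => a [].
rewrite E; split.
  apply: localI; first by apply: local_sub lS => a [ax am]; split=> //; exact: ltnW.
  by apply: local_sub lF => a /= ->.
rewrite (local_indep indX _ lS lF) ?pS; last first.
  by apply/seteqP; split=> // a [[_ /=]] + e; rewrite e/= ltnn.
rewrite exprSr; congr (_ * _).
have mF := local_measurable (local_frog_hits x i 0 h j).
by rewrite -setTD prob_setD// probT prob_frog_hits.
Qed.

Lemma local_missed y m :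
  local xi [set a : step | y < a.1.1 <= y + m%:Z] (missed y m) /\ pr (missed y m) = miss_prob m.
Proof.
elim: m => [|m [lN pN]].
  have -> : missed y 0 = setT by apply/seteqP; split=> // w _ [].
  by rewrite /miss_prob big_geq// probT; split=> //; exact: localT.
have E : missed y m.+1 = missed y m `&` site_missed (y + m.+1%:Z) m.+1 n.
  apply/seteqP; split=> w.
    move=> H; split=> [j jm|i _]; last by apply: H; rewrite leqnn.
    by apply: H; case/andP: jm => -> /leqW.
  move=> [H Hi] j /andP[j0]; rewrite leq_eqVlt => /orP[/eqP ->|jm] i; first exact: Hi.
  by apply: H; rewrite j0.
have [lS pS] := @site_missedP (y + m.+1%:Z) m.+1 n (leqnn n).
rewrite E; split.
  apply: localI; first by apply: local_sub lN => a /=; lia.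
  by apply: local_sub lS => a /= [-> _]; lia.
rewrite (local_indep indX _ lN lS).
  by rewrite pN pS /miss_prob [in RHS]big_nat_recr.
by apply/seteqP; split=> // a /= [h1 [h2 _]]; rewrite h2 in h1; lia.
Qed.

Lemma missed_sub y m m' : (m <= m')%N -> missed y m' `<=` missed y m.
Proof.
by move=> mm' w H j /andP[j0 jm]; apply: H; rewrite j0 (leq_trans jm).
Qed.

(* [covered H k]: each of the sites -1, ..., -k is reached, within h steps, by a
   frog from a site on its right which is not beyond H. *)
Definition covered (H k : nat) : set T :=
  [set w | forall l, (0 < l <= k)%N -> ~ missed (- l%:Z) (l + H) w].

Lemma covered_sub H k k' : (k <= k')%N -> covered H k' `<=` covered H k.
Proof.
by move=> kk' w C l /andP[l0 lk]; apply: C; rewrite l0 (leq_trans lk).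
Qed.

Lemma local_covered H k : local xi [set a : step | - k%:Z < a.1.1] (covered H k).
Proof.
elim: k => [|k IH].
  have -> : covered H 0 = setT by apply/seteqP; split=> // w _ [].
  exact: localT.
have -> : covered H k.+1 = covered H k `&` ~` missed (- k.+1%:Z) (k.+1 + H).
  apply/seteqP; split=> w.
    move=> C; split; first by apply: covered_sub C.
    by apply: C; rewrite leqnn.
  by move=> [C N] l /andP[l0]; rewrite leq_eqVlt => /orP[/eqP ->//|lk]; apply: C; rewrite l0.
apply: localI; first by apply: local_sub IH => a /=; lia.
apply/localC; apply: local_sub (local_missed _ _).1 => a /=; lia.
Qed.

Lemma measurable_covered H k : measurable (covered H k).
Proof. exact: local_measurable (local_covered H k). Qed.

(* Decompose according to the distance i of the nearest frog reaching - k: it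
   is independent of the frogs on the right of it, which must cover - k + i. *)
Lemma prob_covered_rec H k : (0 < k)%N ->
  pr (covered H k) <=
  \sum_(1 <= i < k.+1) (miss_prob i.-1 - miss_prob i) * pr (covered H (k - i)) +
  (miss_prob k - miss_prob (k + H)).
Proof.
move=> k0; pose y : int := - k%:Z.
have mC m := measurable_covered H m.
have mN m := local_measurable (local_missed y m).1.
have part m : (m <= k)%N -> pr (covered H k) <=
    \sum_(1 <= i < m.+1) (miss_prob i.-1 - miss_prob i) * pr (covered H (k - i)) +
    pr (covered H k `&` missed y m).
  elim: m => [_|m IH mk].
    have -> : missed y 0 = setT by apply/seteqP; split=> // w _ [].
    by rewrite big_geq// setIT add0r.
  apply: (le_trans (IH (ltnW mk))); rewrite (big_nat_recr m.+1)//= -addrA lerD2l.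
  (* On [D] the nearest frog reaching - k comes from distance exactly [m.+1]. The event uses frogs
     up to - k + m + 1, and covering up to that site uses only frogs beyond it. *)
  pose D := missed y m `\` missed y m.+1.
  have lD : local xi [set a : step | y < a.1.1 <= y + m.+1%:Z] D.
    apply: localD; last exact: (local_missed _ _).1.
    by apply: local_sub (local_missed y m).1 => a /=; lia.
  have mD := local_measurable lD.
  have <- : pr (D `&` covered H (k - m.+1)) =
     (miss_prob m - miss_prob m.+1) * pr (covered H (k - m.+1)).
    rewrite (local_indep indX _ lD (local_covered H _)).
      congr (_ * _); rewrite prob_setD//; last exact: missed_sub.
      by rewrite !(local_missed _ _).2.
    by apply/seteqP; split=> // a /= []; rewrite /y; lia.
  apply: prob_le_cover; try exact: measurableI.
  move=> w [Cw Nw]; have [N'|N'] := pselect (missed y m.+1 w); [by right|left].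
  by split; [split|apply: covered_sub Cw; exact: leq_subr].
(* What remains is the event that - k is reached from no site within distance [k]; covering then
   forces a frog between the distances [k + 1] and [k + H]. *)
apply: (le_trans (part k (leqnn k))); rewrite lerD2l.
have <- : pr (missed y k `\` missed y (k + H)) = miss_prob k - miss_prob (k + H).
  rewrite prob_setD// ?(local_missed _ _).2//; apply: missed_sub; exact: leq_addr.
apply: prob_le; [exact: measurableI|exact: measurableD|].
by move=> w [Cw Nw]; split=> //; apply: Cw; rewrite k0 leqnn.
Qed.

(** Union bound over the sites - l. Taking [H = 0] restricts to frogs from sites up to the origin,
    the case needed by [covered_visited]. *)
Lemma prob_covered_ge k : 1 - \sum_(1 <= l < k.+1) miss_prob l <= pr (covered 0 k).
Proof.
elim: k => [|k IH].
  have -> : covered 0 0 = setT by apply/seteqP; split=> // w _ [].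
  by rewrite big_geq// subr0 probT.
rewrite big_nat_recr//= -(local_missed (- k.+1%:Z) k.+1).2.
have mC m := measurable_covered 0 m.
have mN := local_measurable (local_missed (- k.+1%:Z) k.+1).1.
have : pr (covered 0 k) <= pr (covered 0 k.+1) + pr (missed (- k.+1%:Z) k.+1).
  apply: prob_le_cover => // w Cw.
  have [N|N] := pselect (missed (- k.+1%:Z) k.+1 w); [by right|left].
  move=> l /andP[l0]; rewrite leq_eqVlt => /orP[/eqP ->|lk]; first by rewrite addn0.
  by apply: Cw; rewrite l0.
by lra.
Qed.
End frog_events.

(** * Dynamics of the frog model *)

Section dynamics.
Variables (n : nat) (c : frog_step n -> bool).

Local Notation act := (activation c).

Lemma displacementE x i t : displacement c x i t = walk (fun u => c (x, i, u)) t.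
Proof. by []. Qed.

Lemma activation_mono t t' x s : (t <= t')%N -> act t x = Some s -> act t' x = Some s.
Proof.
move=> tt' a; rewrite -(subnK tt'); elim: (t' - t)%N => //= k IH.
by rewrite IH.
Qed.

Lemma activation_le t x s : act t x = Some s -> (s <= t)%N /\ act s x = Some s.
Proof.
elim: t s => [|t IH] s /=.
  by case: ifP => // x0 [<-]; rewrite /= x0.
case e : (act t x) => [s'|].
  by move=> [<-]; have [st a] := IH _ e; split=> //; rewrite ltnW.
by case: ifP => // h [<-]; rewrite /= e h.
Qed.

(** Following the chain of activations back in time from a site at or beyond - l, one meets a frog
    which started on the right of - l and ended at or beyond it. *)
Lemma activated_covered t x s l : act t x = Some s -> (0 < l)%N -> x <= - l%:Z ->
  exists (x' : int) i t', - l%:Z < x' /\ x' + displacement c x' i t' <= - l%:Z.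
Proof.
move=> + l0; elim: t x s => [|t IH] x s /=.
  by case: eqP => // -> _; lia.
case e : (act t x) => [s'|]; first by move=> _; apply: IH e.
case: asboolP => // -[x' [i [s' [a' ex]]]] _ xl.
have [x'l|x'l] := lerP x' (- l%:Z); first exact: IH a' x'l.
by exists x', i, (t.+1 - s')%N; rewrite ex.
Qed.

Lemma visited_passes y l : visited c y -> (0 < l)%N -> y <= - l%:Z ->
  exists (x' : int) i t', - l%:Z < x' /\ x' + displacement c x' i t' <= - l%:Z.
Proof.
move=> [t [x [i [s [a e]]]]] l0 yl.
have [xl|xl] := lerP x (- l%:Z); first exact: activated_covered a l0 xl.
by exists x, i, (t - s)%N; rewrite e.
Qed.

Lemma activated_step x i t s y : act s x = Some s -> x + displacement c x i t = y ->
  exists s', act s' y = Some s'.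
Proof.
case: t => [|t] a e.
  by exists s; rewrite -e /displacement big_ord0 addr0.
have [s' es'] : exists s', act (s + t).+1 y = Some s'.
  rewrite /=; case: (act (s + t) y) => [s'|]; first by exists s'.
  exists (s + t).+1; case: asboolP => // -[]; exists x, i, s; split.
    exact: activation_mono (leq_addr _ _) a.
  by rewrite -addnS addKn.
by exists s'; have [] := activation_le es'.
Qed.

Lemma activated_visited y s (i : 'I_n) : act s y = Some s -> visited c y.
Proof.
by move=> a; exists s, y, i, s; rewrite subnn /displacement big_ord0 addr0.
Qed.

Lemma visited0 (i : 'I_n) : visited c 0.
Proof. exact: (@activated_visited _ 0%N i). Qed.
End dynamics.

(** * Comparison of visited sites with covering events *)

Section covered_visited.
Context d (T : measurableType d) (R : realType) (P : probability T R).
Context (n : nat) (xi : frog_step n -> {mfun T >-> bool}).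
Local Notation conf w := (fun a => xi a w).

Lemma visited_covered w y k : visited (conf w) y -> y <= - k%:Z ->
  exists h0, forall h, (h0 <= h)%N -> covered xi h h k w.
Proof.
move=> vy; elim: k => [_|k IH yk].
  by exists 0%N => h _ [|l].
have [|h0 H0] := IH; first by lia.
have [//|x [i [t [xk e]]]] := @visited_passes _ _ _ k.+1 vy _ yk.
(* The common bound [h] must exceed both the time [t] of the crossing frog and its starting site
   [x], as it serves as horizon and as spatial window. *)
exists (maxn h0 (maxn (absz x) t)) => h; rewrite !geq_max => /and3P[hh0 hx ht].
move=> l /andP[l0]; rewrite leq_eqVlt => /orP[/eqP ->|lk]; last first.
  by apply: (H0 h hh0); rewrite l0.
have e1 : (absz (x + k.+1%:Z))%:Z = x + k.+1%:Z by lia.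
move=> /(_ (absz (x + k.+1%:Z))) => /(_ _ i); apply; first by lia.
rewrite e1 /frog_hits /= addrCA addrN addr0; apply: (walk_hits ht).
by move: e; rewrite displacementE e1 => e; have := e; set W := walk _ _; lia.
Qed.

(** With [H = 0] each covering frog starts at a site among 0, ..., - m, which strong induction shows
    to be activated. Hence its walk is really performed. *)
Lemma covered_visited w h k (i0 : 'I_n) : covered xi h 0 k w -> visited (conf w) (- k%:Z).
Proof.
move=> C; suff [s a] : exists s, activation (conf w) s (- k%:Z) = Some s.
  exact: activated_visited i0 a.
suff H m : (m <= k)%N -> exists s, activation (conf w) s (- m%:Z) = Some s by exact: H.
elim/ltn_ind: m => -[|m] IH mk; first by exists 0%N.
have : ~ missed xi h (- m.+1%:Z) m.+1 w by have := C m.+1; rewrite addn0; apply.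
move=> /existsNP[j /not_implyP[/andP[j0 jm] /existsNP[i /contrapT]]].
rewrite /frog_hits /= => /hits_walk[t _ e].
have xE : - m.+1%:Z + j%:Z = - (m.+1 - j)%N%:Z by lia.
have [||s a] := IH (m.+1 - j)%N; [by lia|by lia|].
apply: (@activated_step _ _ (- (m.+1 - j)%N%:Z) i t s) => //.
by rewrite displacementE -xE e; lia.
Qed.
End covered_visited.

(** * Upper bound for the moments *)

Section defective_renewal.
Variable R : realType.
Implicit Types (g a t u : nat -> R).

Lemma convolution_sum g a K :
  \sum_(1 <= k < K.+1) \sum_(1 <= i < k.+1) g i * a (k - i)%N =
  \sum_(1 <= i < K.+1) g i * \sum_(0 <= j < K.+1 - i) a j.
Proof.
elim: K => [|K IH]; first by rewrite !big_geq.
rewrite (big_nat_recr K.+1)//= IH (big_nat_recr K.+1)//= [in RHS](big_nat_recr K.+1)//=.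
rewrite addrA -big_split/= subnn subSnn big_nat1; congr (_ + _).
apply: eq_big_nat => i /andP[_ iK]; rewrite [in RHS]subSn 1?ltnW//.
by rewrite [in RHS]big_nat_recr//= mulrDr.
Qed.

Lemma abel_sum_expr (r : nat -> R) (z : R) K :
  \sum_(1 <= i < K.+1) (r i.-1 - r i) * z ^+ i =
  r 0%N + (z - 1) * (\sum_(0 <= i < K) r i * z ^+ i) - r K * z ^+ K.
Proof.
elim: K => [|K IH]; first by rewrite !big_geq//; ring.
by rewrite (big_nat_recr K.+1)//= IH (big_nat_recr K)//= exprS; ring.
Qed.

(** Multiplying by z^k and summing gives G <= F G + v + B, where F is the truncated generating
    function of the increments of u. The defect v forces F <= 1 - v/2 when z is close to 1. All sums
    stop at [K], so no convergence is involved. *)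
Lemma defective_renewal_bound u t (v z B : R) K :
  (forall k, 0 <= t k) -> t 0%N <= 1 -> u 0%N = 1 ->
  (forall k, u k.+1 <= u k) -> (forall k, (k <= K)%N -> v <= u k) -> 0 < v -> 1 <= z ->
  (forall k, (0 < k <= K)%N ->
     t k <= \sum_(1 <= i < k.+1) (u i.-1 - u i) * t (k - i)%N + (u k - v)) ->
  \sum_(0 <= k < K.+1) (u k - v) * z ^+ k <= B -> (z - 1) * B <= v / 2 ->
  \sum_(0 <= k < K.+1) t k * z ^+ k <= 2 * (v + B) / v.
Proof.
move=> t0 t01 u0 ud uv v0 z1 rec hB hz.
have zk k : 0 <= z ^+ k by rewrite exprn_ge0// (le_trans ler01).
set G := \sum_(0 <= k < K.+1) t k * z ^+ k.
have G0 : 0 <= G by apply: sumr_ge0 => k _; exact: mulr_ge0.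
pose F := \sum_(1 <= i < K.+1) (u i.-1 - u i) * z ^+ i.
pose r k := u k - v.
have FE : F = r 0%N + (z - 1) * (\sum_(0 <= i < K) r i * z ^+ i) - r K * z ^+ K.
  rewrite -abel_sum_expr; apply: eq_bigr => i _; rewrite /r; ring.
have r0 k : (k <= K)%N -> 0 <= r k by move=> kK; rewrite subr_ge0 uv.
(* Abel summation isolates the mass [r 0 = 1 - v]; the excess due to z > 1 is at most (z - 1) B <=
   v/2. *)
have FB : F <= 1 - v / 2.
  have h1 : 0 <= r K * z ^+ K by rewrite mulr_ge0// r0.
  have h2 : \sum_(0 <= i < K) r i * z ^+ i <= B.
    by apply: le_trans hB; rewrite [leRHS]big_nat_recr//= lerDl.
  have h3 : (z - 1) * (\sum_(0 <= i < K) r i * z ^+ i) <= (z - 1) * B.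
    by rewrite ler_wpM2l// subr_ge0.
  by rewrite FE {1}/r u0; lra.
have GF : G <= 1 + (F * G + (B - r 0%N)).
  rewrite {1}/G big_ltn//=; apply: lerD; first by rewrite expr0 mulr1.
  apply: (@le_trans _ _ (\sum_(1 <= k < K.+1)
     (\sum_(1 <= i < k.+1) ((u i.-1 - u i) * z ^+ i) * (t (k - i)%N * z ^+ (k - i)) +
      r k * z ^+ k))).
    apply: ler_sum_nat => k /andP[k0 kK].
    apply: (le_trans (ler_wpM2r (zk k) (rec k _))); first by rewrite k0.
    rewrite mulrDl lerD2r mulr_suml le_eqVlt; apply/orP; left; apply/eqP.
    apply: eq_big_nat => i /andP[_ ik].
    have -> : z ^+ k = z ^+ i * z ^+ (k - i) by rewrite -exprD subnKC.
    ring.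
  rewrite big_split/= (convolution_sum (fun i => (u i.-1 - u i) * z ^+ i)
    (fun j => t j * z ^+ j)); apply: lerD.
    rewrite /F mulr_suml; apply: ler_sum_nat => i /andP[i0 iK].
    rewrite ler_wpM2l ?mulr_ge0 ?subr_ge0//.
      by have := ud i.-1; rewrite prednK.
    rewrite /G [leRHS](@big_cat_nat _ _ _ (K.+1 - i))//=; last exact: leq_subr.
    by rewrite lerDl; apply: sumr_ge0 => k _; exact: mulr_ge0.
  have := hB; rewrite [leLHS]big_ltn//= expr0 mulr1 -/(r 0%N); lra.
rewrite ler_pdivlMr//.
have := ler_wpM2r G0 FB; move: GF; rewrite /r u0; lra.
Qed.
End defective_renewal.

(** One term of the exponential series: this converts the exponential moment into polynomial
    ones. *)
Lemma expn_le_exp (R : realType) (s x : R) j : 0 < s -> 0 <= x ->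
  x ^+ j <= j`!%:R * s ^- j * expR (s * x).
Proof.
move=> s0 x0.
have h : (s * x) ^+ j / j`!%:R <= expR (s * x).
  case: j => [|j]; first by rewrite expr0 fact0 divr1; rewrite -expR0 ler_expR mulr_ge0// ltW.
  have := @expR_ge1Dxn R (s * x) j (mulr_ge0 (ltW s0) x0); lra.
have f0 : 0 < j`!%:R :> R by rewrite ltr0n fact_gt0.
have sj : 0 < s ^+ j by rewrite exprn_gt0.
rewrite mulrAC ler_pdivlMr// mulrC -exprMn [leRHS]mulrC.
by rewrite ler_pdivrMr in h.
Qed.

Lemma subr_expr_le (R : realDomainType) (k m : nat) :
  k.+1%:R ^+ m - k%:R ^+ m <= m%:R * (k.+1%:R ^+ m.-1 : R).
Proof.
case: m => [|m]; first by rewrite !expr0 subrr mul0r.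
rewrite subrXX -natrB// subSnn mul1r /=.
apply: (@le_trans _ _ (\sum_(i < m.+1) k.+1%:R ^+ m)); last first.
  by rewrite sumr_const card_ord mulr_natl.
apply: ler_sum => i _.
have im : (i <= m)%N by rewrite -ltnS.
rewrite -[in leRHS](subnK im) exprD ler_wpM2l ?exprn_ge0//.
by apply: lerXn2r; rewrite ?nnegrE// ler_nat.
Qed.

(** * Estimates for the finite-horizon hitting and missing probabilities *)

Section miss_prob_bounds.
Variables (R : realType) (rho : R).
Hypothesis rho01 : 0 < rho < 1.
Local Notation p := ((1 + rho)^-1).

Let rho0 : 0 < rho. Proof. by case/andP: rho01. Qed.
Let rho1 : rho < 1. Proof. by case/andP: rho01. Qed.
Let ep0 : 0 < 1 - rho. Proof. by rewrite subr_gt0. Qed.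
Let d0 : 0 < 1 + rho. Proof. by rewrite addr_gt0. Qed.
Let p0 : 0 < p. Proof. by rewrite invr_gt0. Qed.
Let p1 : p < 1. Proof. by rewrite invf_lt1// ltrDl. Qed.

Let one_step x : p * x ^+ 2 + (1 - p) = (x ^+ 2 + rho) / (1 + rho).
Proof. by field; rewrite gt_eqF. Qed.

Let rho_harmonic : p * rho ^+ 2 + (1 - p) = rho.
Proof. by rewrite one_step; field; rewrite gt_eqF. Qed.

Lemma ruin_le_rho h j : ruin p h j <= rho ^+ j.
Proof. by apply: ruin_le; rewrite ?rho_harmonic// ltW. Qed.

Lemma ruin_cvg (eta : R) : 0 < eta ->
  (* The value y = sqrt rho minimises (p y^2 + 1 - p) / y; the minimum [lam] is below 1. The error
     lam^h y^j <= lam^h is then uniform in [j]. *)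
  exists h0, forall h, (h0 <= h)%N -> forall j, rho ^+ j - eta <= ruin p h j.
Proof.
move=> eta0; pose y := Num.sqrt rho.
have y0 : 0 < y by rewrite sqrtr_gt0.
have yy : y ^+ 2 = rho by rewrite sqr_sqrtr// ltW.
have y1 : y < 1 by rewrite -(sqrtr1 R) ltr_sqrt.
pose lam := 2 * y / (1 + rho).
have l0 : 0 <= lam by rewrite divr_ge0 ?mulr_ge0// ltW.
have l1 : lam < 1.
  rewrite ltr_pdivrMr// mul1r -yy -subr_gt0.
  have -> : 1 + y ^+ 2 - 2 * y = (1 - y) ^+ 2 by ring.
  by rewrite exprn_gt0// subr_gt0.
have : (fun h => lam ^+ h) @ \oo --> (0 : R) by apply: cvg_expr; rewrite ger0_norm.
move=> /cvgrPdist_le /(_ _ eta0) [h0 _ H]; exists h0 => h hh j.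
have : lam ^+ h <= eta.
  by have := H h hh; rewrite sub0r normrN ger0_norm// exprn_ge0.
have yj : y ^+ j <= 1 by rewrite exprn_ile1// ltW.
have := @ruin_ge _ p p0 p1 h j rho y lam.
have -> : p * y ^+ 2 + (1 - p) <= lam * y.
  have -> : lam * y = (y ^+ 2 + y ^+ 2) / (1 + rho) by rewrite /lam; ring.
  by rewrite one_step yy.
have yr : rho <= y by rewrite -yy expr2 ler_piMl// ltW.
rewrite rho_harmonic yr (ltW y1) l0 (ltW rho0) lexx => /(_ isT isT isT isT isT isT) r le.
apply: le_trans r; rewrite lerD2l lerN2; apply: le_trans le.
by rewrite ler_piMr// exprn_ge0.
Qed.

Variables (n h : nat).
Local Notation u := (miss_prob n rho h).

Let factor01 j : 0 <= 1 - ruin p h j.+1 <= 1.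
Proof.
rewrite subr_ge0 gerBl ruin_ge0// andbT.
by apply: (le_trans (ruin_le_rho _ _)); rewrite exprn_ile1// ltW.
Qed.

Let factorn01 j : 0 <= (1 - ruin p h j.+1) ^+ n <= 1.
Proof. by have /andP[a b] := factor01 j; rewrite exprn_ge0// exprn_ile1. Qed.

Lemma miss_prob0 : u 0 = 1.
Proof. by rewrite /miss_prob big_geq. Qed.

Lemma miss_probS k : u k.+1 = u k * (1 - ruin p h k.+1) ^+ n.
Proof. by rewrite /miss_prob big_nat_recr. Qed.

Lemma miss_prob_ge0 k : 0 <= u k.
Proof.
elim: k => [|k IH]; first by rewrite miss_prob0.
by rewrite miss_probS mulr_ge0//; case/andP: (factorn01 k).
Qed.

Lemma miss_prob_decr k : u k.+1 <= u k.
Proof.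
by rewrite miss_probS ler_piMr ?miss_prob_ge0//; case/andP: (factorn01 k).
Qed.

Lemma miss_prob_antitone k k' : (k <= k')%N -> u k' <= u k.
Proof.
elim: k' => [|k' IH]; first by rewrite leqn0 => /eqP ->.
rewrite leq_eqVlt => /orP[/eqP -> //|kk'].
exact: le_trans (miss_prob_decr _) (IH kk').
Qed.

Let rho_pow j : 0 < 1 - rho ^+ j.+1.
Proof. by rewrite subr_gt0 exprn_ilt1// ltW. Qed.

Lemma miss_prob_ge k :
  expR (- (n%:R * (pi ^+ 2 / 6 / (1 - rho) + ln (1 - rho) / 2))) <= u k.
Proof.
apply: (@le_trans _ _ (expR (n%:R * \sum_(1 <= j < k.+1) ln (1 - rho ^+ j)))).
  rewrite ler_expR -mulrN ler_wpM2l// lerNl; exact: sum_ln_euler_le.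
rewrite expRM_natl expR_sum /miss_prob -prodrXl !big_nat; apply: ler_prod => j /andP[j0 _].
rewrite -(prednK j0); have /andP[a b] := factor01 j.-1.
have r0 := rho_pow j.-1.
rewrite exprn_ge0 ?expR_ge0//=; apply: lerXn2r; rewrite ?nnegrE ?expR_ge0//.
by rewrite lnK ?posrE// lerD2l lerN2 ruin_le_rho.
Qed.

(** Each new factor removes at most the proportion 1 - (1 - x)^n <= n x <= n rho^j, and these
    proportions form a geometric sum. *)
Lemma miss_prob_diff k m : u k - u (k + m) <= u k * (n%:R * rho ^+ k.+1 / (1 - rho)).
Proof.
have H : u k - u (k + m) <= u k * (n%:R * rho ^+ k.+1 * ((1 - rho ^+ m) / (1 - rho))).
  elim: m => [|m IH]; first by rewrite addn0 expr0 !subrr mul0r !mulr0.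
  have st : u (k + m) - u (k + m.+1) <= u k * (n%:R * rho ^+ k.+1 * rho ^+ m).
    rewrite addnS miss_probS -{1}[u (k + m)]mulr1 -mulrBr.
    have /andP[a b] := factorn01 (k + m); have /andP[a' b'] := factor01 (k + m).
    apply: ler_pM; rewrite ?miss_prob_ge0 ?subr_ge0 ?miss_prob_antitone ?leq_addr//.
    set x := ruin _ _ _ in a' b' *.
    have x1 : x <= 1 by move: a'; rewrite subr_ge0.
    have x0 : 0 <= x by exact: ruin_ge0.
    apply: (@le_trans _ _ (n%:R * x)).
      elim: (n) => [|i IHi]; first by rewrite expr0 subrr mul0r.
      rewrite exprSr mulrSr mulrDl mul1r.
      have : (1 - x) ^+ i * x <= x by rewrite ler_piMl// exprn_ile1.
      lra.
    by rewrite -mulrA -exprD addSn ler_wpM2l// ruin_le_rho.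
  have -> : u k - u (k + m.+1) = (u k - u (k + m)) + (u (k + m) - u (k + m.+1)) by ring.
  apply: (le_trans (lerD IH st)); rewrite -mulrDr -mulrDr le_eqVlt.
  apply/orP; left; apply/eqP; congr (_ * (_ * _)); rewrite exprS.
  by move: (rho ^+ m) => x; field; rewrite gt_eqF.
apply: (le_trans H); rewrite ler_wpM2l ?miss_prob_ge0//.
rewrite ler_wpM2l ?mulr_ge0 ?exprn_ge0 ?(ltW rho0)//.
by rewrite ler_pdivrMr// mulVf ?gt_eqF// gerBl exprn_ge0// ltW.
Qed.
End miss_prob_bounds.

Definition euler_exponent (R : realType) (rho : R) : R :=
  pi ^+ 2 / 6 / (1 - rho) + ln (1 - rho) / 2.

Definition moment_bound (R : realType) (n m : nat) (rho : R) : R :=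
  m`!%:R * (16 * n%:R / (1 - rho) * expR (n%:R * euler_exponent rho)) ^+ m.

Section moment_sum.
Context d (T : measurableType d) (R : realType) (P : probability T R).
Context (n : nat) (xi : frog_step n -> {mfun T >-> bool}) (rho : R).
Hypotheses (n0 : (0 < n)%N) (rho01 : 0 < rho < 1) (law : frog_law rho P xi).

(** By summation by parts the left side is a truncated [m]-th moment. The bound is uniform in [H],
    [K] and large [h], which allows the passage to the limit. *)
Lemma covered_moment_sum m : (0 < m)%N -> exists h0, forall h, (h0 <= h)%N -> forall H K,
  \sum_(1 <= k < K.+1) (k%:R ^+ m - k.-1%:R ^+ m) * prob P (covered xi h H k) <=
  moment_bound n m rho.
Proof.
move=> m0; have /andP[rho0 rho1] := rho01.
have ep0 : 0 < 1 - rho by rewrite subr_gt0.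
have [h0 near] := ruin_cvg rho01 ep0.
exists h0 => h hh H K.
pose u := miss_prob n rho h.
pose L := euler_exponent rho.
pose Q := expR (- (n%:R * L)).
have Q0 : 0 < Q by exact: expR_gt0.
have Qu k : Q <= u k by exact: miss_prob_ge.
have u0 : u 0%N = 1 by exact: miss_prob0.
have Q1 : Q <= 1 by rewrite -u0.
have nn0 : 1 <= n%:R :> R by rewrite ler1n.
have nn : n%:R != 0 :> R by rewrite gt_eqF// (lt_le_trans ltr01).
have epn : 1 - rho != 0 by rewrite gt_eqF.
have Qn : Q != 0 by rewrite gt_eqF.
(* The rate [s] is chosen so that [2 * s * B = Q / 2], hence (z - 1) B <= v/2 for z = exp s and v >=
   Q. *)
pose s := Q * (1 - rho) / (16 * n%:R).
have d0 : 0 < 16 * n%:R :> R by rewrite mulr_gt0// (lt_le_trans ltr01).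
have s0 : 0 < s by rewrite divr_gt0// mulr_gt0.
have sE : s * (16 * n%:R) = Q * (1 - rho) by rewrite /s mulfVK// gt_eqF.
have qep : Q * (1 - rho) <= 1 - rho by rewrite ler_piMl// ltW.
have s_ep : s * 16 <= 1 - rho.
  apply: le_trans qep; rewrite -sE mulrA ler_peMr// mulr_ge0// ltW//.
have [z1 z2] : 1 <= expR s /\ expR s <= 1 + 2 * s.
  split; first by rewrite -expR0 ler_expR ltW.
  have h1 : 1 - s <= (expR s)^-1 by rewrite -expRN; exact: expR_ge1Dx.
  have h2 : 0 < 1 - s by lra.
  have h3 : expR s <= (1 - s)^-1.
    by rewrite -[leLHS]invrK lef_pV2 ?posrE ?invr_gt0 ?expR_gt0.
  apply: (le_trans h3); rewrite -[leLHS]mul1r ler_pdivrMr//.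
  have : 0 <= s * (1 - 2 * s) by rewrite mulr_ge0//; lra.
  lra.
pose z := expR s.
pose B := 4 * n%:R / (1 - rho).
have zr : rho * z <= 1 - (1 - rho) / 2.
  have : rho * z <= rho * (1 + 2 * s) by rewrite ler_wpM2l// ltW.
  have : rho * (2 * s) <= 2 * s by rewrite ler_piMl ?ltW// mulr_gt0.
  lra.
(* The factor at distance 1 alone is of order 1 - rho. It cancels the denominator in
   [miss_prob_diff], so that B is of order 1 / (1 - rho) and not of its square. *)
have u1 k : u k.+1 <= 2 * (1 - rho).
  apply: (le_trans (miss_prob_antitone rho01 _ _ (ltn0Sn k))).
  rewrite miss_probS miss_prob0 mul1r -(prednK n0) exprS.
  set x := ruin _ _ _.
  have x0 : 0 <= x by apply: ruin_ge0; rewrite ?invr_gt0 ?invf_lt1 ?ltrDl// addr_gt0.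
  have xl : x <= rho by have := ruin_le_rho rho01 h 1; rewrite expr1.
  have xg : rho - (1 - rho) <= x by have := near h hh 1%N; rewrite expr1.
  have x1 : 0 <= 1 - x by lra.
  apply: (@le_trans _ _ (1 - x)); last by lra.
  by rewrite ler_piMr// exprn_ile1//; lra.
have uB k m' : u k - u (k + m')%N <= 2 * n%:R * rho ^+ k.
  have [->|k0] := posnP k.
    rewrite u0 expr0 mulr1 add0n; have := lt_le_trans Q0 (Qu m'); lra.
  apply: (le_trans (miss_prob_diff rho01 _ _ _ _)).
  rewrite -/u; have := u1 k.-1; rewrite prednK// => uk.
  have nr : 0 <= n%:R * rho ^+ k.+1 / (1 - rho).
    apply: divr_ge0; last exact: ltW.
    by rewrite mulr_ge0// exprn_ge0// ltW.
  apply: (le_trans (ler_wpM2r nr uk)).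
  have -> : 2 * (1 - rho) * (n%:R * rho ^+ k.+1 / (1 - rho)) = 2 * n%:R * rho ^+ k * rho.
    by rewrite exprS; field; rewrite gt_eqF.
  by rewrite ler_piMr ?(ltW rho1)// !mulr_ge0// exprn_ge0 ?ltW.
(* This stands for u_oo: it is below every [u (k + H)] with [k <= K]. *)
pose v := u (K + H)%N.
have v0 : 0 < v := lt_le_trans Q0 (Qu _).
pose t k := prob P (covered xi h H k).
have Rb : \sum_(0 <= k < K.+1) (u k - v) * z ^+ k <= B.
  apply: (@le_trans _ _ (\sum_(0 <= k < K.+1) 2 * n%:R * (rho * z) ^+ k)).
    apply: ler_sum_nat => k /andP[_ kK].
    rewrite exprMn mulrA ler_wpM2r ?exprn_ge0 ?expR_ge0//.
    have -> : v = u (k + (K + H - k))%N by rewrite subnKC// (leq_trans _ (leq_addr _ _)).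
    exact: uB.
  rewrite -mulr_sumr big_mkord.
  have rz0 : 0 <= rho * z by rewrite mulr_ge0 ?expR_ge0 ?ltW.
  have rz1 : 0 < 1 - rho * z by lra.
  have geo : \sum_(i < K.+1) (rho * z) ^+ i <= 2 / (1 - rho).
    have := subrX1 (rho * z) K.+1; set S := \sum_(_ < _) _ => e.
    have S0 : 0 <= S by apply: sumr_ge0 => i _; exact: exprn_ge0.
    rewrite ler_pdivlMr//.
    have : S * ((1 - rho) / 2) <= S * (1 - rho * z) by rewrite ler_wpM2l//; lra.
    have := exprn_ge0 K.+1 rz0; move: e; rewrite mulrC; lra.
  have -> : B = 2 * n%:R * (2 / (1 - rho)) by rewrite /B; ring.
  by rewrite ler_wpM2l// mulr_ge0.
have zB : (z - 1) * B <= v / 2.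
  have B0 : 0 <= B by apply: divr_ge0; [exact: mulr_ge0|exact: ltW].
  have e : 2 * s * B = Q / 2.
    by rewrite /s /B; field; rewrite nn epn.
  have h1 : (z - 1) * B <= 2 * s * B by rewrite ler_wpM2r//; rewrite /z; lra.
  have := Qu (K + H)%N; rewrite -/v; lra.
have G : \sum_(0 <= k < K.+1) t k * z ^+ k <= 2 * (v + B) / v.
  apply: (@defective_renewal_bound _ u t v z B K) => //.
  - by move=> k; exact: prob_ge0.
  - by apply: prob_le1; exact: (measurable_covered law).
  - by move=> k; exact: miss_prob_decr.
  - by move=> k kK; apply: miss_prob_antitone => //; rewrite (leq_trans kK)// leq_addr.
  - move=> k /andP[k0 kK]; apply: (le_trans (prob_covered_rec law h H k0)).
    rewrite lerD2l lerD2l lerN2; apply: miss_prob_antitone => //.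
    by rewrite leq_add2r.
have Gs : 2 * (v + B) / v <= s^-1.
  have v1 : v <= 1 by rewrite -u0; exact: miss_prob_antitone.
  have n4 : 1 <= n%:R / (1 - rho) by rewrite ler_pdivlMr//; lra.
  have vB : 2 * (v + B) <= 16 * n%:R / (1 - rho) by rewrite /B; lra.
  have -> : s^-1 = 16 * n%:R / (1 - rho) / Q.
    by rewrite /s; field; rewrite nn epn Qn.
  apply: ler_pM => //; rewrite ?invr_ge0 ?(ltW v0)//.
    apply: mulr_ge0 => //; apply: addr_ge0; first exact: ltW.
    by apply: divr_ge0; [exact: mulr_ge0|exact: ltW].
  by rewrite lef_pV2 ?posrE// Qu.
have mE : moment_bound n m rho = m`!%:R * s ^- m.
  rewrite /moment_bound -exprVn /s invfM invrK; congr (_ * _ ^+ _).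
  rewrite /Q expRN invfM invrK -/L; ring.
rewrite mE.
(* One factor s^-1 comes from the exponential moment; the others come from k^m - (k-1)^m <= m
   k^(m-1) and [expn_le_exp] with exponent m - 1. *)
have D : m`!%:R * s ^- m = (m%:R * (m.-1`!%:R * s ^- m.-1)) * s^-1.
  rewrite -{1 2}(prednK m0) factS natrM exprSr invfM; rewrite prednK//; ring.
rewrite D.
have C0 : 0 <= m%:R * (m.-1`!%:R * s ^- m.-1).
  by rewrite !mulr_ge0// invr_ge0 exprn_ge0// ltW.
apply: le_trans (ler_wpM2l C0 (le_trans G Gs)).
rewrite [in leRHS]big_ltn// mulrDr.
apply: (@le_trans _ _ (m%:R * (m.-1`!%:R * s ^- m.-1) * (\sum_(1 <= k < K.+1) t k * z ^+ k))); last first.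
  by rewrite lerDr mulr_ge0// mulr_ge0 ?prob_ge0// exprn_ge0// expR_ge0.
rewrite mulr_sumr; apply: ler_sum_nat => k /andP[k0 kK].
rewrite -/(t k) [t k * _]mulrC [leRHS]mulrA ler_wpM2r ?prob_ge0//.
apply: (@le_trans _ _ (m%:R * k%:R ^+ m.-1)).
  by have := subr_expr_le R k.-1 m; rewrite prednK.
rewrite -[leRHS]mulrA ler_wpM2l//.
rewrite /z -expRM_natr; exact: expn_le_exp.
Qed.
End moment_sum.

Lemma lee_expe (R : realDomainType) (x y : \bar R) m :
  (0 <= x -> x <= y -> x ^+ m <= y ^+ m)%E.
Proof.
move=> x0 xy; elim: m => [|m IH]; first by rewrite !expe0.
by rewrite !expeS; apply: lee_pmul => //; exact: expe_ge0.
Qed.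

(* [ge0_le_integral] does not apply, [neg_leftmost] not being known to be measurable. *)
Lemma le_integral_nonneg d (T : measurableType d) (R : realType)
    (mu : {measure set T -> \bar R}) (f g : T -> \bar R) :
  (forall w, 0 <= f w)%E -> (forall w, f w <= g w)%E ->
  (\int[mu]_w f w <= \int[mu]_w g w)%E.
Proof.
move=> f0 fg; have g0 w : (0 <= g w)%E by apply: le_trans (fg w).
rewrite !ge0_integralTE//; apply: ge_ereal_sup => _ [h hf <-].
by apply: ereal_sup_ubound; exists h => //= w; apply: le_trans (fg w).
Qed.

Section indicator_sums.
Context d (T : measurableType d) (R : realType) (P : probability T R).
Context (I : Type) (a : I -> R) (A : I -> set T).
Hypotheses (a0 : forall k, 0 <= a k) (mA : forall k, measurable (A k)).

Let term k w : \bar R := (a k * \1_(A k) w)%:E.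

Let sumE s w : (\sum_(k <- s) a k * \1_(A k) w)%:E = (\sum_(k <- s) term k w)%E.
Proof. by rewrite sumEFin. Qed.

Let term_meas k : measurable_fun setT (term k).
Proof.
apply/measurable_EFinP; apply: measurable_funM; first exact: measurable_cst.
exact: measurable_realfun.measurable_indic.
Qed.

Let term_ge0 k w : (0 <= term k w)%E.
Proof. by rewrite lee_fin mulr_ge0// indicE. Qed.

Lemma measurable_indicator_sum s :
  measurable_fun setT (fun w => (\sum_(k <- s) a k * \1_(A k) w)%:E : \bar R).
Proof.
rewrite (_ : (fun w => _) = fun w => (\sum_(k <- s) term k w)%E); last exact/funext/sumE.
exact: emeasurable_sum.
Qed.

Lemma integral_indicator_sum s :
  (\int[P]_w (\sum_(k <- s) a k * \1_(A k) w)%:E =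
  (\sum_(k <- s) a k * prob P (A k))%:E)%E.
Proof.
under eq_integral do rewrite sumE.
rewrite ge0_integral_sum// -sumEFin; apply: eq_bigr => k _.
have := @integralZl_indic _ _ _ P setT measurableT (fun=> A k) (a k).
rewrite /term => ->//; last by rewrite ltNge a0.
by rewrite integral_indic// setIT EFinM -(probE P (mA k)).
Qed.
End indicator_sums.

Section upper_moment.
Context d (T : measurableType d) (R : realType) (P : probability T R).
Context (n : nat) (xi : frog_step n -> {mfun T >-> bool}) (rho : R).
Hypotheses (n0 : (0 < n)%N) (rho01 : 0 < rho < 1) (law : frog_law rho P xi).
Local Notation conf w := (fun a => xi a w).

Lemma neg_leftmost_ge (w : T) k : visited (conf w) (- k%:Z) ->
  ((k%:R : R)%:E <= neg_leftmost R (conf w))%E.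
Proof.
move=> v; rewrite /neg_leftmost leeNr; apply: ereal_inf_lbound.
by exists (- k%:Z) => //; rewrite mulrNz EFinN.
Qed.

Lemma neg_leftmost_ge0 (w : T) : (0 <= neg_leftmost R (conf w))%E.
Proof. by apply: (@neg_leftmost_ge w 0); exact: visited0 (Ordinal n0). Qed.

Lemma missed_time_mono h h' y m : (h <= h')%N -> missed xi h' y m `<=` missed xi h y m.
Proof.
move=> hh w M j jm i; have := M j jm i; rewrite /frog_hits /= => N H; apply: N.
exact: hits_mono H.
Qed.

Lemma covered_mono h h' H H' k : (h <= h')%N -> (H <= H')%N ->
  covered xi h H k `<=` covered xi h' H' k.
Proof.
move=> hh HH w C l lk M; apply: (C l lk); apply: (missed_time_mono hh).
by apply: missed_sub M; rewrite leq_add2l.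
Qed.

(** Horizon, window and number of sites all grow with [N]. The weighted indicators increase to a
    limit dominating the integrand, and monotone convergence transfers the uniform bound. *)
Lemma frog_moment_le m : (0 < m)%N -> (frog_moment m P xi <= (moment_bound n m rho)%:E)%E.
Proof.
move=> m0; have [h0 bound] := covered_moment_sum n0 rho01 law m0.
pose a k : R := k%:R ^+ m - k.-1%:R ^+ m.
have a0 k : 0 <= a k.
  by rewrite subr_ge0; apply: lerXn2r; rewrite ?nnegrE// ler_nat leq_pred.
pose A N k := covered xi (h0 + N) (h0 + N) k.
have mA N k : measurable (A N k) by exact: (measurable_covered law).
pose g N w := (\sum_(1 <= k < N.+1) a k * \1_(A N k) w)%:E.
have g_ge0 N w : (0 <= g N w)%E.
  by rewrite lee_fin; apply: sumr_ge0 => k _; rewrite mulr_ge0// indicE.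
have mono w : nondecreasing_seq (g^~ w).
  move=> N N' NN'; rewrite lee_fin.
  rewrite [leRHS](@big_cat_nat _ _ _ N.+1)//=.
  apply: ler_wpDr; first by apply: sumr_ge0 => k _; rewrite mulr_ge0// indicE.
  apply: ler_sum_nat => k _; rewrite ler_wpM2l// !indicE ler_nat.
  have [wA|//] := boolP (w \in A N k).
  rewrite mem_set//; apply: covered_mono (set_mem wA); by rewrite leq_add2l.
have lim_ge w k y : visited (conf w) y -> y <= - k%:Z ->
    ((k%:R ^+ m)%:E <= limn (g^~ w))%E.
  move=> vy yk; have [h1 cov] := @visited_covered _ _ n xi w y k vy yk.
  apply: lime_ge; first exact: ereal_nondecreasing_is_cvgn.
  exists (maxn h1 k) => // N /=; rewrite geq_max => /andP[h1N kN].
  rewrite lee_fin [leRHS](@big_cat_nat _ _ _ k.+1)//=.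
  apply: ler_wpDr; first by apply: sumr_ge0 => j _; rewrite mulr_ge0// indicE.
  have -> : k%:R ^+ m = \sum_(1 <= j < k.+1) a j.
    by rewrite big_add1/= telescope_sumr// expr0n gtn_eqF// subr0.
  apply: ler_sum_nat => j /andP[_ jk].
  rewrite indicE mem_set ?mulr1//.
  apply: (@covered_sub _ _ _ xi _ _ j k jk); apply: cov.
  by rewrite (leq_trans h1N)// leq_addl.
have up : (\int[P]_w limn (g^~ w) <= (moment_bound n m rho)%:E)%E.
  rewrite monotone_convergence//; last first.
    by move=> N; apply: measurable_indicator_sum.
  apply: lime_le.
    apply: ereal_nondecreasing_is_cvgn => N N' NN'; apply: le_integral_nonneg => // w.
    exact: mono.
  by apply: nearW => N; rewrite /g integral_indicator_sum// lee_fin; apply: bound; exact: leq_addr.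
apply: le_trans up; rewrite /frog_moment.
apply: le_integral_nonneg => w; first exact/expe_ge0/neg_leftmost_ge0.
(* If arbitrarily negative sites are visited, the limit is infinite and nothing is left to prove.
   Otherwise the least [k] beyond which no site is visited locates the leftmost site. *)
have [all_vis|/existsNP[k1 Nk1]] := pselect (forall k : nat,
    exists2 y, visited (conf w) y & y <= - k%:Z).
  rewrite (_ : limn _ = +oo%E) ?leey//; apply: eq_infty => r.
  have [y vy yk] := all_vis (Num.truncn `|r|).+1.
  apply: le_trans (lim_ge _ _ _ vy yk); rewrite lee_fin.
  apply: (le_trans (ler_norm r)).
  apply: (@le_trans _ _ (Num.truncn `|r|).+1%:R); first by apply/ltW/truncnS_gt.
  by rewrite ler_eXnr// ler1n.
pose nv k := `[< ~ exists2 y, visited (conf w) y & y <= - k%:Z >].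
have exnv : exists k, nv k by exists k1; exact/asboolP.
case: (ex_minnP exnv) => -[|k] /asboolP Nk kmin.
  by case: Nk; exists 0 => //; exact: visited0 (Ordinal n0).
have [y vy yk] : exists2 y, visited (conf w) y & y <= - k%:Z.
  apply: contrapT => N; have := kmin k; rewrite ltnn => H.
  by have := H (introT (asboolP _) N).
apply: (le_trans _ (lim_ge _ _ _ vy yk)); rewrite EFin_expe.
apply: lee_expe; first exact: neg_leftmost_ge0.
rewrite /neg_leftmost leeNl -EFinN; apply: le_ereal_inf_tmp => _ [z vz <-].
rewrite lee_fin; have : - k%:Z <= z.
  rewrite leNgt; apply/negP => zk; apply: Nk; exists z => //.
  by move: zk; lia.
by rewrite -(ler_int R) mulrNz.
Qed.
End upper_moment.

(** * Lower bound for the moments *)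

Section lower_moment.
Context d (T : measurableType d) (R : realType) (P : probability T R).
Context (n : nat) (xi : frog_step n -> {mfun T >-> bool}) (rho : R).
Hypotheses (n0 : (0 < n)%N) (rho01 : 0 < rho < 1) (law : frog_law rho P xi).

Lemma frog_moment_ge0 m : (0 <= frog_moment m P xi)%E.
Proof. by apply: integral_ge0 => w _; apply/expe_ge0/neg_leftmost_ge0. Qed.

(** Markov's inequality at level [k], the covering event being contained in the event that - k is
    visited. *)
Lemma frog_moment_ge_covered m h k :
  ((k%:R ^+ m * prob P (covered xi h 0 k))%:E <= frog_moment m P xi)%E.
Proof.
pose g w := (\sum_(i <- [:: tt]) k%:R ^+ m * \1_(covered xi h 0 k) w)%:E : \bar R.
have mC : measurable (covered xi h 0 k) by exact: (measurable_covered law).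
have km0 : 0 <= k%:R ^+ m :> R by exact: exprn_ge0.
have <- : (\int[P]_w g w = (k%:R ^+ m * prob P (covered xi h 0 k))%:E)%E.
  by rewrite /g integral_indicator_sum// big_seq1.
apply: le_integral_nonneg => w; rewrite /g big_seq1 indicE.
  by rewrite lee_fin mulr_ge0.
have [wC|_] := boolP (w \in covered xi h 0 k); last first.
  by rewrite mulr0; apply/expe_ge0/neg_leftmost_ge0.
rewrite mulr1 EFin_expe; apply: lee_expe; first by rewrite lee_fin.
exact/neg_leftmost_ge/(covered_visited (Ordinal n0))/(set_mem wC).
Qed.

(* Union bound: the probability that - l is missed halves with each of the first
   K + 1 sites on its right, whose frogs reach - l with probability at least 1/2. *)
Lemma frog_moment_ge m K : 12 * (1 - rho) <= 1 -> K.+2%:R * (1 - rho) <= 1 / 2 ->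
  (((2 ^+ K) ^+ m / 2)%:E <= frog_moment m P xi)%E.
Proof.
move=> ep12 epK; have /andP[rho0 rho1] := rho01.
set ep := 1 - rho in ep12 epK *.
have ep0 : 0 < ep by rewrite subr_gt0.
have [h near] := ruin_cvg rho01 ep0; have {}near := near h (leqnn h).
have [p0 p1] : 0 < (1 + rho)^-1 /\ (1 + rho)^-1 < 1.
  by rewrite invr_gt0 invf_lt1 ?ltrDl addr_gt0.
pose u := miss_prob n rho h.
(* Bernoulli's inequality for rho^(j+1) costs (j + 1) ep, and the finite horizon costs one more
   ep. *)
have factor j : 0 <= (1 - ruin (1 + rho)^-1 h j.+1) ^+ n <= j.+2%:R * ep.
  set x := ruin _ _ _.
  have x0 : 0 <= x by exact: ruin_ge0.
  have x1 : x <= 1.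
    by apply: (le_trans (ruin_le_rho rho01 _ _)); rewrite exprn_ile1// ltW.
  rewrite exprn_ge0 ?subr_ge0//= -(prednK n0) exprS.
  apply: (@le_trans _ _ (1 - x)).
    by rewrite ler_piMr ?exprn_ile1 ?subr_ge0 ?gerBl.
  have := near j.+1; rewrite -/x => xn.
  have bern i : 1 - i%:R * ep <= rho ^+ i.
    elim: i => [|i IH]; first by rewrite mul0r subr0.
    have r1 : rho ^+ i <= 1 by rewrite exprn_ile1// ltW.
    have : ep * rho ^+ i <= ep by rewrite ler_piMr// ltW.
    by rewrite exprS mulrSr mulrDl mul1r /ep in IH *; lra.
  by have := bern j.+1; rewrite [j.+2%:R]mulrSr mulrDl mul1r; lra.
have u1 : u 1%N <= 2 * ep.
  by rewrite /u miss_probS miss_prob0 mul1r; case/andP: (factor 0%N).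
have small l : (l <= K)%N -> u l.+1 <= 2 * ep / 2 ^+ l.
  elim: l => [_|l IH lK]; first by rewrite expr0 divr1.
  rewrite /u miss_probS exprS invfM mulrCA mulrC.
  have /andP[f0 f1] := factor l.+1.
  apply: ler_pM => //; [exact: (miss_prob_ge0 rho01)| |exact: IH (ltnW lK)].
  apply: (le_trans f1); apply: (@le_trans _ _ (K.+2%:R * ep)).
    by rewrite ler_wpM2r ?(ltW ep0)// ler_nat !ltnS.
  by rewrite -[leRHS]mul1r.
(* Beyond [K] monotonicity keeps the last bound. Summed over 2^K sites, the two terms give at most 4
   ep + 2 ep, which explains the hypothesis on 12 ep. *)
have ub l : u l.+1 <= 2 * ep / 2 ^+ l + 2 * ep / 2 ^+ K.
  have [lK|Kl] := leqP l K.
    apply: (le_trans (small l lK)); rewrite lerDl divr_ge0 ?exprn_ge0// mulr_ge0// ltW//.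
  have h1 : u l.+1 <= u K.+1.
    by apply: (miss_prob_antitone rho01); rewrite ltnS ltnW.
  apply: (le_trans (le_trans h1 (small K (leqnn K)))).
  by rewrite lerDr divr_ge0 ?exprn_ge0// mulr_ge0// ltW.
have geo N : \sum_(0 <= l < N) (2 * ep / 2 ^+ l) = 4 * ep - 4 * ep / 2 ^+ N.
  elim: N => [|N IH]; first by rewrite big_geq// expr0 divr1 subrr.
  rewrite big_nat_recr//= IH exprS invfM; lra.
pose N := (2 ^ K)%N.
have N2 : N%:R = 2 ^+ K :> R by rewrite natrX.
have p2 : 0 < 2 ^+ K :> R by rewrite exprn_gt0.
have sum_le : \sum_(1 <= l < N.+1) u l <= 1 / 2.
  rewrite big_add1/=; apply: (@le_trans _ _
    (\sum_(0 <= l < N) (2 * ep / 2 ^+ l + 2 * ep / 2 ^+ K))).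
    by apply: ler_sum_nat => l _; exact: ub.
  rewrite big_split/= geo sumr_const_nat subn0 -[X in _ + X]mulr_natr N2 mulfVK ?gt_eqF//.
  have : 0 <= 4 * ep / 2 ^+ N by rewrite divr_ge0 ?exprn_ge0// mulr_ge0// ltW.
  lra.
apply: le_trans (frog_moment_ge_covered m h N); rewrite lee_fin N2.
rewrite ler_wpM2l ?exprn_ge0 ?(ltW p2)//.
apply: le_trans (prob_covered_ge law h N); move: sum_le; rewrite /u; lra.
Qed.
End lower_moment.

(** * Asymptotic comparison *)

Lemma equiv_at_1_near (R : realType) (f g : R -> R) :
  (\forall x \near 1^'-, f x = g x /\ g x != 0) -> equiv_at_1 f g.
Proof.
move=> fg; apply/cvgrPdist_le => e e0; near=> x.
have [-> gx] : f x = g x /\ g x != 0 by near: x.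
by rewrite divff// subrr normr0 ltW.
Unshelve. all: by end_near.
Qed.

Lemma near_left1 (R : realType) (e : R) : 0 < e ->
  \forall x \near 1^'-, 0 < x < 1 /\ 1 - x < e.
Proof.
move=> e0; near=> x.
have x1 : x < 1 by near: x; exact: nbhs_left_lt.
have x0 : 0 < x by near: x; apply: nbhs_left_gt; exact: ltr01.
split; first by rewrite x0.
suff : 1 - e < x by lra.
by near: x; apply: nbhs_left_gt; rewrite gtrBl.
Unshelve. all: by end_near.
Qed.

Section comparison.
Variables (R : realType) (n m : nat).
Hypotheses (n0 : (0 < n)%N) (m0 : (0 < m)%N).

Definition upper_target (rho : R) : R :=
  Zrho rho ^+ m * ((1 - rho) / (2 * pi)) `^ (n%:R / 2) *
  expR (pi ^+ 2 / 6 * ((m * n)%:R / (1 - rho))).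

Definition lower_target (delta : R -> R) (rho : R) : R :=
  m`!%:R * Zrho rho ^+ m * expR ((m * n)%:R / (1 - rho) `^ delta rho).

Lemma Zrho_gt0 (rho : R) : 0 < rho < 1 -> 0 < Zrho rho.
Proof.
move=> /andP[r0 r1]; rewrite /Zrho -mulrNN -invrN.
by rewrite divr_gt0// oppr_gt0 ln_lt0// ?r0// subr_gt0 r1 gtrBl.
Qed.

Lemma upper_target_gt0 rho : 0 < rho < 1 -> 0 < upper_target rho.
Proof.
move=> rho01; have /andP[r0 r1] := rho01.
rewrite !mulr_gt0 ?expR_gt0 ?exprn_gt0 ?Zrho_gt0// powR_gt0//.
by rewrite divr_gt0 ?mulr_gt0 ?pi_gt0// subr_gt0.
Qed.

Lemma lower_target_gt0 delta rho : 0 < rho < 1 -> 0 < lower_target delta rho.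
Proof.
by move=> rho01; rewrite !mulr_gt0 ?expR_gt0 ?exprn_gt0 ?Zrho_gt0// ltr0n fact_gt0.
Qed.

(** The exponentials agree, and ep^(nm/2) <= ep^(n/2) because m >= 1. The constants are absorbed by
    ep * Z, which grows at least like - ln ep / 2. *)
Lemma moment_bound_le_target :
  \forall rho \near (1 : R)^'-, moment_bound n m rho <= upper_target rho.
Proof.
pose D : R := (2 * pi) `^ (n%:R / 2).
pose C : R := m`!%:R * (16 * n%:R * D).
(* The bound 1/2 gives - ln rho <= 2 ep; the other one gives - ln ep >= 2 C. Together they yield C
   <= ep * Z. *)
have e0 : 0 < Num.min (1 / 2) (expR (- (2 * C))) by rewrite lt_min expR_gt0 divr_gt0.
near=> rho.
have [rho01] : 0 < rho < 1 /\ 1 - rho < Num.min (1 / 2) (expR (- (2 * C))).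
  by near: rho; exact: near_left1.
rewrite lt_min => /andP[half small]; have /andP[r0 r1] := rho01.
set ep := 1 - rho in half small.
have ep0 : 0 < ep by rewrite subr_gt0.
have ep1 : ep <= 1 by rewrite gerBl ltW.
have pi2 : 0 < 2 * pi :> R by rewrite mulr_gt0// pi_gt0.
have D1 : 1 <= D.
  rewrite /D -[leLHS](powRr0 (2 * pi)) ler_powR ?divr_ge0//.
  by have := pi_ge2 R; lra.
have D0 : 0 <= D := le_trans ler01 D1.
have n1 : 1 <= n%:R :> R by rewrite ler1n.
have f1 : 1 <= m`!%:R :> R by rewrite ler1n fact_gt0.
have EZ : C <= ep * Zrho rho.
  have l1 : - ln rho <= 2 * ep.
    rewrite -lnV ?posrE//; have h := @le_ln1Dx R (rho^-1 - 1).
    rewrite addrCA subrr addr0 in h; apply: (le_trans (h _)).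
      by rewrite ltrBrDr addNr invr_gt0.
    have -> : rho^-1 - 1 = ep / rho by rewrite /ep; field; rewrite gt_eqF.
    rewrite ler_pdivrMr//; have : 0 <= ep * (2 * rho - 1).
      by rewrite mulr_ge0 ?(ltW ep0)//; move: half; rewrite /ep; lra.
    by lra.
  have l0 : 0 < - ln rho by rewrite oppr_gt0 ln_lt0// r0.
  have lep : 2 * C <= - ln ep.
    by rewrite lerNr -(expRK (- (2 * C))) ler_ln ?posrE ?expR_gt0// ltW.
  have -> : Zrho rho = - ln ep / - ln rho by rewrite /Zrho invrN mulrNN.
  rewrite mulrA ler_pdivlMr//.
  have C0 : 0 <= C by rewrite /C !mulr_ge0.
  apply: (@le_trans _ _ (C * (2 * ep))); first by rewrite ler_wpM2l.
  have := ler_wpM2l (ltW ep0) lep; lra.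
rewrite /moment_bound /upper_target -/ep.
have expE : expR (n%:R * euler_exponent rho) ^+ m =
    expR (pi ^+ 2 / 6 * ((m * n)%:R / ep)) * ep `^ (n%:R / 2 * m%:R).
  rewrite /euler_exponent -/ep -expRM_natl /powR gt_eqF// -expRD natrM; congr expR.
  by ring.
have targetE : (ep / (2 * pi)) `^ (n%:R / 2) = ep `^ (n%:R / 2) / D.
  rewrite powRM ?invr_ge0 ?(ltW ep0) ?(ltW pi2)//; congr (_ * _).
  by rewrite -(powR_inv1 (ltW pi2)) -powRrM mulN1r powRN.
have coef : m`!%:R * (16 * n%:R / ep) ^+ m <= Zrho rho ^+ m / D.
  rewrite expr_div_n mulrA ler_pdivlMr ?(lt_le_trans ltr01 D1)//.
  rewrite mulrAC ler_pdivrMr ?exprn_gt0// -exprMn [Zrho _ * _]mulrC.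
  apply: (@le_trans _ _ (C ^+ m)); last first.
    apply: lerXn2r; rewrite ?nnegrE//; last by rewrite mulr_ge0 ?ltW ?Zrho_gt0.
    by rewrite /C !mulr_ge0.
  have -> : C ^+ m = m`!%:R ^+ m * ((16 * n%:R) ^+ m * D ^+ m).
    by rewrite /C exprMn; congr (_ * _); rewrite exprMn.
  rewrite -mulrA; apply: ler_pM.
  - exact: ler0n.
  - by apply: mulr_ge0; rewrite ?exprn_ge0// mulr_ge0.
  - by rewrite ler_eXnr.
  - by rewrite ler_wpM2l ?exprn_ge0 ?mulr_ge0// ler_eXnr.
have pw : ep `^ (n%:R / 2 * m%:R) <= ep `^ (n%:R / 2).
  apply: ger_powR; first by rewrite ep0.
  by rewrite ler_peMr ?divr_ge0// ler1n.
rewrite exprMn expE targetE.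
set E2 := expR (pi ^+ 2 / 6 * _); set A := ep `^ _ in pw *; set B := ep `^ _ in pw *.
have -> : m`!%:R * ((16 * n%:R / ep) ^+ m * (E2 * A)) =
  (m`!%:R * (16 * n%:R / ep) ^+ m) * A * E2 by ring.
have -> : Zrho rho ^+ m * (B / D) * E2 = (Zrho rho ^+ m / D) * B * E2 by ring.
rewrite ler_wpM2r ?expR_ge0//; apply: ler_pM => //.
- by rewrite mulr_ge0// exprn_ge0// divr_ge0 ?mulr_ge0// ltW.
- exact: powR_ge0.

Unshelve. all: by end_near.
Qed.
End comparison.

(** The largest depth K with (K + 2)(1 - rho) <= 1/2; the truncated subtraction is exact near 1. *)
Definition dyadic_depth (R : realType) (rho : R) : nat :=
  (Num.truncn (1 / (2 * (1 - rho))) - 2)%N.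

(** With x = ep^(-1/2), delta <= 1/2 gives ep^(-delta) <= x, while Z <= x^4 <= exp(4x). The target
    is thus at most the [m]-th power of an exponential linear in x, whereas 2^K grows exponentially
    in x^2. *)
Lemma lower_target_le (R : realType) (n m : nat) (delta : R -> R) :
  (0 < m)%N -> delta @ 1^'- --> (0 : R) ->
  \forall rho \near (1 : R)^'-, [/\ 12 * (1 - rho) <= 1,
    (dyadic_depth rho).+2%:R * (1 - rho) <= 1 / 2 &
    lower_target n m delta rho <= (2 ^+ dyadic_depth rho) ^+ m / 2].
Proof.
move=> m0 d0.
pose c : R := 2 * m`!%:R.
(* For x >= X0 one has (n + c + 6) x <= x^2 / 4. Here c pays for m! and the division by 2, 4 of the
   6 units for Z, and the other 2 for the rounding in (t - 2) / 2. *)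
pose X0 : R := 4 * (n%:R + c + 6).
have c0 : 0 <= c by rewrite mulr_ge0.
have nn0 : 0 <= n%:R :> R by [].
have X00 : 0 < X0 by rewrite /X0; lra.
have e0 : 0 < Num.min (1 / 12) (X0 ^- 2) by rewrite lt_min invr_gt0 exprn_gt0// divr_gt0.
near=> rho.
have [rho01] : 0 < rho < 1 /\ 1 - rho < Num.min (1 / 12) (X0 ^- 2).
  by near: rho; exact: near_left1.
rewrite lt_min => /andP[ep12 small]; have /andP[r0 r1] := rho01.
have dh : delta rho <= 1 / 2.
  by near: rho; apply: (cvgr_le _ d0); rewrite divr_gt0.
have ZE : Zrho rho = - ln (1 - rho) / - ln rho by rewrite /Zrho invrN mulrNN.
rewrite /lower_target /dyadic_depth ZE.
have lr : 1 - rho <= - ln rho.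
  by have := @le_ln1Dx R (rho - 1); rewrite [1 + _]addrC subrK ltrBrDr addNr => /(_ r0); lra.
set ep := 1 - rho in ep12 small lr *.
have ep0 : 0 < ep by rewrite subr_gt0.
have ep1 : ep <= 1 by rewrite gerBl ltW.
pose x := (Num.sqrt ep)^-1.
have s0 : 0 < Num.sqrt ep by rewrite sqrtr_gt0.
have x0 : 0 < x by rewrite invr_gt0.
have xx : x ^+ 2 = ep^-1 by rewrite /x exprVn sqr_sqrtr// ltW.
have xX : X0 <= x.
  have h : X0 ^+ 2 <= x ^+ 2.
    by rewrite xx -[leLHS]invrK lef_pV2 ?posrE ?invr_gt0 ?exprn_gt0// ltW.
  by move: h; rewrite ler_pXn2r// nnegrE ltW.
set t := Num.truncn (1 / (2 * ep)).
have tE : 1 / (2 * ep) = x ^+ 2 / 2 by rewrite xx; field; rewrite gt_eqF.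
have t_le : t%:R <= x ^+ 2 / 2.
  rewrite -tE; suff /truncn_itv/andP[] : 0 <= 1 / (2 * ep) by [].
  by rewrite divr_ge0// mulr_ge0// ltW.
have t_gt : x ^+ 2 / 2 < t%:R + 1 by rewrite -tE natr1; exact: truncnS_gt.
have x_1 : 1 <= x by apply: le_trans xX; rewrite /X0; lra.
have key : (n%:R + c + 6) * x <= x ^+ 2 / 4.
  have := ler_wpM2r (ltW x0) xX; rewrite /X0 -expr2; lra.
have cx : c <= c * x by rewrite ler_peMr.
have t2 : (2 <= t)%N.
  have nx : 0 <= n%:R * x by rewrite mulr_ge0// ltW.
  have : (1 : R) < t%:R by lra.
  by rewrite ltr1n.
split.
- lra.
- have -> : (t - 2).+2 = t by rewrite -addn2 subnK.
  have : t%:R * ep <= x ^+ 2 / 2 * ep by rewrite ler_wpM2r// ltW.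
  by rewrite xx mulrAC mulVf ?gt_eqF.
have tK : (t - 2)%:R = t%:R - 2 :> R by rewrite natrB.
have pw : (ep `^ delta rho)^-1 <= x.
  rewrite /x lef_pV2 ?posrE ?powR_gt0//.
  rewrite -powR12_sqrt ?(ltW ep0)//; apply: ger_powR; first by rewrite ep0.
  by rewrite -[2^-1]mul1r.
have Zx : - ln ep / - ln rho <= x ^+ 4.
  have -> : x ^+ 4 = ep^-1 * ep^-1 by rewrite -xx; ring.
  have lep : - ln ep <= ep^-1.
    by rewrite -lnV ?posrE//; apply/ltW/ln_sublinear; rewrite invr_gt0.
  apply: ler_pM => //.
  - by rewrite oppr_ge0 ln_le0.
  - by rewrite invr_ge0 (le_trans (ltW ep0)).
  - by rewrite lef_pV2 ?posrE ?(lt_le_trans ep0 lr).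
have Zp : 0 <= - ln ep / - ln rho.
  by rewrite divr_ge0 ?oppr_ge0 ?ln_le0// ltW.
have xe : x <= expR x by apply: le_trans (expR_ge1Dx x); rewrite lerDr.
have f1 : 1 <= 2 * m`!%:R :> R.
  have : 1 <= m`!%:R :> R by rewrite ler1n fact_gt0.
  lra.
have ce : 2 * m`!%:R <= expR c by apply: le_trans (expR_ge1Dx c); rewrite /c; lra.
have two : expR (1 / 2) <= 2 :> R.
  have h : 1 - 1 / 2 <= (expR (1 / 2))^-1 :> R by rewrite -expRN; exact: expR_ge1Dx.
  rewrite -[leLHS]invrK -[leRHS]invrK lef_pV2 ?posrE ?invr_gt0 ?expR_gt0//; lra.
move: (- ln ep / - ln rho) Zp Zx => Z Zp Zx.
rewrite ler_pdivlMr//.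
apply: (@le_trans _ _ ((expR c * expR x ^+ 4 * expR (n%:R * x)) ^+ m)).
  rewrite 2!exprMn.
  have expm : expR ((m * n)%:R / ep `^ delta rho) <= expR (n%:R * x) ^+ m.
    rewrite -expRM_natl ler_expR natrM -mulrA ler_wpM2l// ler_wpM2l//.
  have -> (a b e : R) : a * b * e * 2 = 2 * a * b * e by ring.
  apply: ler_pM; rewrite ?expR_ge0//.
    by apply: mulr_ge0; rewrite ?mulr_ge0 ?exprn_ge0.
  apply: ler_pM; rewrite ?mulr_ge0 ?exprn_ge0//.
    apply: (@le_trans _ _ ((2 * m`!%:R) ^+ m)); first by rewrite ler_eXnr.
    by apply: lerXn2r; rewrite ?nnegrE ?mulr_ge0 ?expR_ge0.
  apply: lerXn2r; rewrite ?nnegrE ?exprn_ge0 ?expR_ge0//.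
  apply: (le_trans Zx); apply: lerXn2r; rewrite ?nnegrE ?expR_ge0// ltW//.
apply: lerXn2r; rewrite ?nnegrE ?mulr_ge0 ?exprn_ge0 ?expR_ge0//.
apply: (@le_trans _ _ (expR (1 / 2) ^+ (t - 2))); last first.
  by apply: lerXn2r; rewrite ?nnegrE ?expR_ge0.
rewrite -!expRM_natl -!expRD ler_expR tK; lra.
Unshelve. all: by end_near.
Qed.

Theorem theorem1 (R : realType) (n m : nat) (hn : (0 < n)%N) (hm : (0 < m)%N) :
  (exists phi : R -> R,
     [/\ forall rho, 0 < rho < 1 -> 0 <= phi rho,
         forall rho, 0 < rho < 1 ->
           forall (d : measure_display) (T : measurableType d)
             (P : probability T R) (xi : frog_step n -> {mfun T >-> bool}),
           frog_law rho P xi -> (frog_moment m P xi <= (phi rho)%:E)%E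
       & equiv_at_1 phi (fun rho =>
           Zrho rho ^+ m * ((1 - rho) / (2 * pi)) `^ (n%:R / 2) *
           expR (pi ^+ 2 / 6 * ((m * n)%:R / (1 - rho))))]) /\
  (forall delta : R -> R,
     (forall rho, 0 < rho < 1 -> 0 < delta rho < 1) ->
     delta @ 1^'- --> (0 : R) ->
     (fun rho => (1 - rho) `^ delta rho) @ 1^'- --> (0 : R) ->
     exists psi : R -> R,
     [/\ forall rho, 0 < rho < 1 -> 0 <= psi rho,
         forall rho, 0 < rho < 1 ->
           forall (d : measure_display) (T : measurableType d)
             (P : probability T R) (xi : frog_step n -> {mfun T >-> bool}),
           frog_law rho P xi -> ((psi rho)%:E <= frog_moment m P xi)%E
       & equiv_at_1 psi (fun rho =>
           m`!%:R * Zrho rho ^+ m *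
           expR ((m * n)%:R / (1 - rho) `^ delta rho))]).
Proof.
split.
  (* The maximum is an upper bound for every rho, and it coincides with the target once
     [moment_bound] lies below. *)
  exists (fun rho => Num.max (moment_bound n m rho) (upper_target n m rho)); split.
  - by move=> rho rho01; rewrite le_max [X in _ || X]ltW ?orbT// upper_target_gt0.
  - move=> rho rho01 d T P xi law.
    apply: (le_trans (frog_moment_le hn rho01 law hm)).
    by rewrite lee_fin le_max lexx.
  - apply: (@equiv_at_1_near _ _ (upper_target n m)).
    near=> rho; split.
      by apply/max_idPr; near: rho; exact: moment_bound_le_target.
    have [rho01 _] : 0 < rho < 1 /\ 1 - rho < 1 by near: rho; exact: near_left1.
    by rewrite gt_eqF// upper_target_gt0.
move=> delta _ delta0 _.
(* Where these conditions fail, the default value 0 is a lower bound since the moment is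
   nonnegative. *)
pose ok (rho : R) := [&& 12 * (1 - rho) <= 1,
  (dyadic_depth rho).+2%:R * (1 - rho) <= 1 / 2 &
  lower_target n m delta rho <= (2 ^+ dyadic_depth rho) ^+ m / 2].
exists (fun rho => if ok rho then lower_target n m delta rho else 0); split.
- by move=> rho rho01; case: ifP => // _; rewrite ltW// lower_target_gt0.
- move=> rho rho01 d T P xi law; case: ifP => [/and3P[h1 h2 h3]|_].
    apply: le_trans (frog_moment_ge hn rho01 law m h1 h2); exact: h3.
  exact: frog_moment_ge0.
- apply: (@equiv_at_1_near _ _ (lower_target n m delta)).
  near=> rho; split.
    have [h1 h2 h3] : [/\ 12 * (1 - rho) <= 1,
      (dyadic_depth rho).+2%:R * (1 - rho) <= 1 / 2 &
      lower_target n m delta rho <= (2 ^+ dyadic_depth rho) ^+ m / 2].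
      by near: rho; exact: lower_target_le.
    by rewrite /ok h1 h2 h3.
  have [rho01 _] : 0 < rho < 1 /\ 1 - rho < 1 by near: rho; exact: near_left1.
  by rewrite gt_eqF// lower_target_gt0.
Unshelve. all: by end_near.
Qed.
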